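(* Let $E_1,E_2$ be isogenous complex elliptic curves without complex multiplication, $X=E_1\times E_2$, and $d$ the minimal degree of an isogeny $E_1\to E_2$. Then $X$ carries no irreducible principal polarization if and only if $d=1$, or $d$ is an idoneal number with $d\equiv 2,4,6 \pmod 8$ (i.e. $d$ even, idoneal, and not divisible by $8$).
   Context: A principal polarization on $X$ is an ample line bundle class $L$ with $L^2=2$; it is reducible if $L\equiv E_1'+E_2'$ with elliptic curves $E_1',E_2'$, $E_1'\cdot E_2'=1$, irreducible otherwise. Idoneal numbers (Euler's numeri idonei) are characterized (Grube) as follows: an integer $n\ge1$ is idoneal iff for every $B\in\{1,\dots,\lfloor\sqrt{n/3}\rfloor\}$ and every representation $n+B^2=AC$ with $2B\le A\le C$ and $\gcd(A,2B,C)=1$, one has $A=C$ or $A=2B$. *)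

(* Defs.v *)
From Stdlib Require Import Reals ZArith Arith.
From Coquelicot Require Import Coquelicot.
Open Scope R_scope.

(** * Complex elliptic curves  E_tau = C / (Z + tau Z),  Im tau > 0.
    Every complex elliptic curve is isomorphic to such an E_tau. *)

Definition CofZ (m : Z) : C := RtoC (IZR m).

Definition inLattice (tau z : C) : Prop :=
  exists m n : Z, z = Cplus (CofZ m) (Cmult (CofZ n) tau).

(** E_tau has complex multiplication: End(E_tau) is bigger than Z, i.e.
    some non-real alpha satisfies alpha (Z + tau Z) ⊆ Z + tau Z. *)
Definition hasCM (tau : C) : Prop :=
  exists alpha : C, Im alpha <> 0 /\ inLattice tau alpha /\ inLattice tau (Cmult alpha tau).

(** An isogeny E_tau1 -> E_tau2 is induced by z |-> alpha z with alpha <> 0 and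
    alpha (Z + tau1 Z) ⊆ Z + tau2 Z; writing alpha = a + b tau2,
    alpha tau1 = c + e tau2, its degree (= index [Λ2 : alpha Λ1]) is |a e - b c|. *)
Definition isogeny_of_degree (tau1 tau2 : C) (n : nat) : Prop :=
  exists (alpha : C) (a b c e : Z),
    alpha <> RtoC 0 /\
    alpha = Cplus (CofZ a) (Cmult (CofZ b) tau2) /\
    Cmult alpha tau1 = Cplus (CofZ c) (Cmult (CofZ e) tau2) /\
    Z.of_nat n = Z.abs (a * e - b * c)%Z.

Definition minimal_isogeny_degree (tau1 tau2 : C) (d : nat) : Prop :=
  isogeny_of_degree tau1 tau2 d /\
  forall n, isogeny_of_degree tau1 tau2 n -> (d <= n)%nat.

(** * The abelian surface X = E_tau1 x E_tau2 = C^2 / Λ,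
    Λ = Z e1 + Z e2 + Z e3 + Z e4 with e1=(1,0), e2=(tau1,0), e3=(0,1), e4=(0,tau2).
    This basis is positively oriented for the complex orientation. *)

Record V4 := mkV4 { x1 : R; x2 : R; x3 : R; x4 : R }.   (* real lattice coordinates *)
Record Z4 := mkZ4 { n1 : Z; n2 : Z; n3 : Z; n4 : Z }.   (* integer lattice coordinates *)

Definition realvec (u : Z4) : V4 :=
  mkV4 (IZR (n1 u)) (IZR (n2 u)) (IZR (n3 u)) (IZR (n4 u)).

Definition toC2 (tau1 tau2 : C) (x : V4) : C * C :=
  (Cplus (RtoC (x1 x)) (Cmult (RtoC (x2 x)) tau1),
   Cplus (RtoC (x3 x)) (Cmult (RtoC (x4 x)) tau2)).

(** from C^2 to lattice coordinates (inverse of toC2 when Im tau_i <> 0) *)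
Definition coords (tau1 tau2 : C) (z : C * C) : V4 :=
  let b1 := Im (fst z) / Im tau1 in
  let b2 := Im (snd z) / Im tau2 in
  mkV4 (Re (fst z) - b1 * Re tau1) b1 (Re (snd z) - b2 * Re tau2) b2.

Definition mulI (z : C * C) : C * C := (Cmult Ci (fst z), Cmult Ci (snd z)).

(** * H^2(X,Z) = Alt^2(Λ, Z): integer alternating forms on Λ, given by their
    values a_ij = E(e_i, e_j), i < j. *)
Record Alt := mkAlt { a12 : Z; a13 : Z; a14 : Z; a23 : Z; a24 : Z; a34 : Z }.

Definition addAlt (A B : Alt) : Alt :=
  mkAlt (a12 A + a12 B) (a13 A + a13 B) (a14 A + a14 B)
        (a23 A + a23 B) (a24 A + a24 B) (a34 A + a34 B).

Definition evalAlt (A : Alt) (x y : V4) : R :=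
  IZR (a12 A) * (x1 x * x2 y - x2 x * x1 y) +
  IZR (a13 A) * (x1 x * x3 y - x3 x * x1 y) +
  IZR (a14 A) * (x1 x * x4 y - x4 x * x1 y) +
  IZR (a23 A) * (x2 x * x3 y - x3 x * x2 y) +
  IZR (a24 A) * (x2 x * x4 y - x4 x * x2 y) +
  IZR (a34 A) * (x3 x * x4 y - x4 x * x3 y).

Definition formC2 (tau1 tau2 : C) (A : Alt) (z w : C * C) : R :=
  evalAlt A (coords tau1 tau2 z) (coords tau1 tau2 w).

(** Intersection (cup) product  (A . B) = <A ∧ B, e1 ∧ e2 ∧ e3 ∧ e4>;
    in particular (A . A) = 2 Pf(A). *)
Definition intAlt (A B : Alt) : Z :=
  (a12 A * a34 B + a34 A * a12 B - a13 A * a24 B - a24 A * a13 B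
   + a14 A * a23 B + a23 A * a14 B)%Z.

(** Néron–Severi group (Appell–Humbert / Lefschetz (1,1)):
    classes E in Alt^2(Λ,Z) with E(iz, iw) = E(z, w). *)
Definition isNS (tau1 tau2 : C) (A : Alt) : Prop :=
  forall z w : C * C, formC2 tau1 tau2 A (mulI z) (mulI w) = formC2 tau1 tau2 A z w.

(** Ampleness: the associated hermitian form is positive definite
    (sign normalised so that classes of curves, defined below, are nef). *)
Definition ampleNS (tau1 tau2 : C) (A : Alt) : Prop :=
  forall z : C * C, z <> (RtoC 0, RtoC 0) -> 0 < formC2 tau1 tau2 A z (mulI z).

Definition principal_polarization (tau1 tau2 : C) (A : Alt) : Prop :=
  isNS tau1 tau2 A /\ ampleNS tau1 tau2 A /\ intAlt A A = 2%Z.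

(** * Elliptic curves in X: E' = W / (W ∩ Λ) for a complex line W ⊂ C^2 with
    W ∩ Λ of rank 2.  We describe E' by a basis (u, v) of W ∩ Λ which is
    positively oriented for the complex orientation of W (v = λ u, Im λ > 0). *)
Definition elliptic_curve_basis (tau1 tau2 : C) (u v : Z4) : Prop :=
  toC2 tau1 tau2 (realvec u) <> (RtoC 0, RtoC 0) /\
  (exists lam : C, 0 < Im lam /\
     toC2 tau1 tau2 (realvec v) =
       (Cmult lam (fst (toC2 tau1 tau2 (realvec u))),
        Cmult lam (snd (toC2 tau1 tau2 (realvec u))))) /\
  (* (u, v) is a Z-basis of W ∩ Λ, W = R u + R v *)
  (forall (x : Z4) (s t : R),
     realvec x = mkV4 (s * IZR (n1 u) + t * IZR (n1 v)) (s * IZR (n2 u) + t * IZR (n2 v))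
                      (s * IZR (n3 u) + t * IZR (n3 v)) (s * IZR (n4 u) + t * IZR (n4 v)) ->
     exists m k : Z,
       x = mkZ4 (m * n1 u + k * n1 v) (m * n2 u + k * n2 v)
                (m * n3 u + k * n3 v) (m * n4 u + k * n4 v))%Z.

(** the class c1(O_X(E')) ∈ Alt^2(Λ,Z): Poincaré dual of [E'] = u ∧ v,
    i.e. (x, y) |-> det[x, y, u, v]. *)
Definition minor (u v : Z4) (k l : Z4 -> Z) : Z := (k u * l v - l u * k v)%Z.

Definition curve_class (u v : Z4) : Alt :=
  mkAlt (minor u v n3 n4) (- minor u v n2 n4)%Z (minor u v n2 n3)
        (minor u v n1 n4) (- minor u v n1 n3)%Z (minor u v n1 n2).

Definition reducible_pp (tau1 tau2 : C) (A : Alt) : Prop :=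
  exists u1 v1 u2 v2 : Z4,
    elliptic_curve_basis tau1 tau2 u1 v1 /\
    elliptic_curve_basis tau1 tau2 u2 v2 /\
    intAlt (curve_class u1 v1) (curve_class u2 v2) = 1%Z /\
    A = addAlt (curve_class u1 v1) (curve_class u2 v2).

Definition irreducible_pp (tau1 tau2 : C) (A : Alt) : Prop :=
  principal_polarization tau1 tau2 A /\ ~ reducible_pp tau1 tau2 A.

(** * Idoneal numbers (Grube's characterization) *)
Definition idoneal (n : nat) : Prop :=
  (1 <= n)%nat /\
  forall B A C : nat,
    (1 <= B)%nat -> (3 * (B * B) <= n)%nat ->
    (n + B * B = A * C)%nat -> (2 * B <= A)%nat -> (A <= C)%nat ->
    Nat.gcd (Nat.gcd A (2 * B)) C = 1%nat ->
    A = C \/ A = (2 * B)%nat.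

(* Main.v *)
Require Import Defs.
From Stdlib Require Import Reals ZArith Arith.
From Stdlib Require Import Znumtheory Lia Lra Psatz Classical.
From Coquelicot Require Import Coquelicot.

(** Since the curves have no complex multiplication, the classes in NS(X) are triples (a, b, c)
    with (a, b, c)^2 = 2 (a b - d c^2).  Attach to a principal polarization L = (a, b, c) the
    binary form g = (b, 2dc, ad), of determinant d.  L is reducible iff there is an isotropic
    class E with L.E = 1, and such an E amounts to an integral rank one projector that is
    self-adjoint for g, that is, to an equivalence of g with a diagonal form (e, 0, f), ef = d.

    If d = 1, or d is even, idoneal and not divisible by 8, then g reduces to (A, 2B, C) with
    B = 0, A = C or A = 2B, and parity excludes the last two cases.  Otherwise there is an L
    without projector: (2, (d + 1) / 2, 1) if d is odd, and else one whose g is equivalent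
    to (4, 4, d / 4 + 1) if 8 divides d, or to a form (A, 2B, C) with 0 < 2B < A < C violating
    idoneality: every primitive form of determinant d is equivalent to some g, because it
    represents a number prime to d. *)

Open Scope Z_scope.

(** * Binary quadratic forms *)

Lemma exists_prime_divisor (n : Z) : 1 < n -> exists l, prime l /\ (l | n).
Proof.
  intros Hn; generalize Hn.
  refine (Zlt_lower_bound_ind (fun n => 1 < n -> exists l, prime l /\ (l | n)) 1 _ n _); [|lia].
  intros m IH _ Hm.
  destruct (prime_dec m) as [Hp|Hp]; [exists m; split; [exact Hp|apply Z.divide_refl]|].
  destruct (not_prime_divide m Hm Hp) as (k & Hk & Hkm).
  destruct (IH k) as (l & Hl & Hlk); [lia|lia|].
  exists l; split; [exact Hl|now apply Z.divide_trans with k].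
Qed.

Lemma rel_prime_of_no_common_prime (a b : Z) :
  (forall l, prime l -> (l | a) -> (l | b) -> False) -> rel_prime a b.
Proof.
  intros H; apply Zgcd_1_rel_prime.
  pose proof (Z.gcd_nonneg a b) as Hg.
  destruct (Z.eq_dec (Z.gcd a b) 0) as [H0|H0].
  - exfalso; apply Z.gcd_eq_0 in H0 as [-> ->].
    apply (H 2 prime_2); apply Z.divide_0_r.
  - destruct (Z.eq_dec (Z.gcd a b) 1) as [H1|H1]; [exact H1|exfalso].
    destruct (exists_prime_divisor (Z.gcd a b)) as (l & Hl & Hd); [lia|].
    apply (H l Hl); eapply Z.divide_trans; eauto using Z.gcd_divide_l, Z.gcd_divide_r.
Qed.

(** Induction on [n], one prime at a time: [Q l] depends only on [t] modulo [l], so Bezout glues a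
    witness for the cofactor to one for the new prime. *)
Lemma chinese_remainder_primes (Q : Z -> Z -> Prop) (n : Z) :
  (forall l t k, Q l t -> Q l (t + l * k)) -> 0 < n ->
  (forall l, prime l -> (l | n) -> exists t, Q l t) ->
  exists t, forall l, prime l -> (l | n) -> Q l t.
Proof.
  intros HQ Hn.
  refine (Zlt_lower_bound_ind (fun n =>
    (forall l, prime l -> (l | n) -> exists t, Q l t) ->
    exists t, forall l, prime l -> (l | n) -> Q l t) 1 _ n _); [|lia].
  intros m IH Hm Hex.
  destruct (Z.eq_dec m 1) as [->|Hm1].
  - exists 0; intros l Hl Hd; exfalso.
    pose proof (prime_ge_2 l Hl).
    apply Z.divide_1_r_nonneg in Hd; lia.
  - destruct (exists_prime_divisor m) as (l & Hl & [m' Hm']); [lia|].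
    pose proof (prime_ge_2 l Hl) as Hl2.
    destruct (IH m') as (t' & Ht'); [nia| |].
    { intros l' Hl' Hd; apply Hex; [exact Hl'|rewrite Hm'; now apply Z.divide_mul_l]. }
    destruct (Zdivide_dec l m') as [Hd|Hd].
    + exists t'; intros l' Hl' Hd'; apply Ht'; [exact Hl'|].
      rewrite Hm' in Hd'; destruct (prime_mult l' Hl' _ _ Hd') as [H|H]; [exact H|].
      now rewrite (prime_div_prime l' l Hl' Hl H).
    + destruct (rel_prime_bezout _ _ (prime_rel_prime l Hl m' Hd)) as [u v Huv].
      destruct (Hex l Hl) as (tl & Htl); [exists m'; exact Hm'|].
      (* As [u * l + v * m' = 1], this is [t'] modulo every divisor of [m'] and [tl] modulo [l]. *)
      exists (t' + m' * (v * (tl - t'))); intros l' Hl' Hd'.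
      rewrite Hm' in Hd'; destruct (prime_mult l' Hl' _ _ Hd') as [[q Hq]|H].
      * replace (m' * (v * (tl - t'))) with (l' * (q * (v * (tl - t')))) by (rewrite Hq; ring).
        apply HQ, Ht'; [exact Hl'|now exists q].
      * rewrite (prime_div_prime l' l Hl' Hl H).
        replace (t' + m' * (v * (tl - t'))) with (tl + l * (- u * (tl - t'))).
        { now apply HQ. }
        replace (m' * (v * (tl - t'))) with ((v * m') * (tl - t')) by ring.
        replace (v * m') with (1 - u * l) by lia; ring.
Qed.

Lemma divide_shift (l x y k : Z) : y = x + l * k -> (l | x) <-> (l | y).
Proof.
  intros ->; split; intros [q Hq].
  - exists (q + k); rewrite Hq; ring.
  - exists (q - k); lia.
Qed.

(** * Primitive forms and the polarizations attached to them *)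

Definition primitive_form (A B C : Z) : Prop :=
  forall l, prime l -> (l | A) -> (l | 2 * B) -> (l | C) -> False.

(* Modulo a prime, a primitive form takes a non-zero value at one of (1,0), (0,1), (1,1). *)
Lemma primitive_form_coprime_value (A B C d : Z) :
  0 < d ->
  primitive_form A B C ->
  exists r s, rel_prime r s /\ rel_prime (A * r * r + 2 * B * r * s + C * s * s) d.
Proof.
  intros Hd Hprim.
  destruct (Z.eq_dec d 1) as [->|Hd1].
  { exists 1, 0; split; [apply rel_prime_1|apply rel_prime_sym, rel_prime_1]. }
  pose (g r s := A * r * r + 2 * B * r * s + C * s * s).
  (* First [s] is chosen so that some [r] works modulo each prime divisor of [d], then these [r] are
     glued. Dividing by gcd(r, s) afterwards keeps the value prime to [d]. *)
  destruct (chinese_remainder_primes (fun l s => exists r, ~ (l | g r s)) d) as (s & Hs); [|exact Hd| |].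
  { intros l s k [r Hr]; exists r; intros H; apply Hr; revert H.
    apply (divide_shift l (g r s) _ (k * (2 * B * r + 2 * C * s + C * l * k))); unfold g; ring. }
  { intros l Hl _.
    destruct (Zdivide_dec l A) as [HA|HA]; [|exists 0, 1; unfold g; now replace (_ + _) with A by ring].
    destruct (Zdivide_dec l C) as [HC|HC]; [|exists 1, 0; unfold g; now replace (_ + _) with C by ring].
    exists 1, 1; intros H; apply (Hprim l Hl HA); [|exact HC].
    destruct HA as [u Hu], HC as [v Hv], H as [w Hw]; unfold g in Hw.
    exists (w - u - v); lia. }
  destruct (chinese_remainder_primes (fun l r => ~ (l | g r s)) d) as (r & Hr); [|exact Hd|exact Hs|].
  { intros l r k Hn H; apply Hn; revert H.
    apply (divide_shift l (g r s) _ (k * (2 * B * s + 2 * A * r + A * l * k))); unfold g; ring. }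
  destruct (exists_prime_divisor d) as (l0 & Hl0 & Hl0d); [lia|].
  pose proof (Z.gcd_nonneg r s) as Hg0.
  destruct (Z.gcd_divide_l r s) as [r' Hr'], (Z.gcd_divide_r r s) as [s' Hs'].
  destruct (Z.eq_dec (Z.gcd r s) 0) as [H0|H0].
  { exfalso; apply Z.gcd_eq_0 in H0 as [-> ->]; apply (Hr l0 Hl0 Hl0d).
    exists 0; unfold g; ring. }
  exists r', s'; split.
  - apply bezout_rel_prime; destruct (Z.gcd_bezout r s (Z.gcd r s) eq_refl) as (u & v & Huv).
    exists u v; apply (Z.mul_reg_r _ _ (Z.gcd r s)); [exact H0|].
    transitivity (u * (r' * Z.gcd r s) + v * (s' * Z.gcd r s)); [ring|].
    rewrite <- Hr', <- Hs', Huv; ring.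
  - apply rel_prime_of_no_common_prime; intros l Hl Hlg Hld; apply (Hr l Hl Hld).
    replace (g r s) with ((A * r' * r' + 2 * B * r' * s' + C * s' * s') * (Z.gcd r s * Z.gcd r s)).
    { now apply Z.divide_mul_l. }
    transitivity (g (r' * Z.gcd r s) (s' * Z.gcd r s)); [unfold g; ring|].
    now rewrite <- Hr', <- Hs'.
Qed.

(** Take a primitive vector with value [b] prime to [d], complete it to a basis, and shift the
    second vector to make the off-diagonal coefficient a multiple of [d]. The determinant then
    forces [d] to divide the last coefficient. *)
Lemma polarization_of_form (A B C d : Z) :
  0 < d -> 0 < A -> A * C - B * B = d ->
  primitive_form A B C ->
  exists a b c m1 m2 m3 m4,
    m1 * m4 - m2 * m3 = 1 /\ 0 < a /\ a * b - d * c * c = 1 /\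
    b = A * m1 * m1 + 2 * B * m1 * m3 + C * m3 * m3 /\
    d * c = A * m1 * m2 + B * (m1 * m4 + m2 * m3) + C * m3 * m4 /\
    d * a = A * m2 * m2 + 2 * B * m2 * m4 + C * m4 * m4.
Proof.
  intros Hd HA Hdet Hprim.
  destruct (primitive_form_coprime_value A B C d Hd Hprim) as (r & s & Hrs & Hcop).
  destruct (rel_prime_bezout _ _ Hrs) as [u v Huv].
  destruct (rel_prime_bezout _ _ Hcop) as [y x Hxy].
  remember (A * r * r + 2 * B * r * s + C * s * s) as b eqn:Hb.
  assert (Hb0 : 0 < b).
  { assert (0 < A * b); [|nia].
    replace (A * b) with ((A * r + B * s) * (A * r + B * s) + d * (s * s)) by (rewrite Hb, <- Hdet; ring).
    pose proof (Z.square_nonneg (A * r + B * s)).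
    destruct (Z.eq_dec s 0) as [->|Hs0]; [|assert (0 < s * s) by nia; nia].
    assert (r <> 0) by (intros ->; lia).
    assert (0 < (A * r) * (A * r)) by nia. nia. }
  (* [h] is the off-diagonal coefficient in the basis (r, s), (-v, u). Subtracting [y * h] times the
     first vector turns it into [h - y * h * b], which is [d * (x * h)] since
     [y * b + x * d = 1]. *)
  set (h := A * r * - v + B * (r * u + - v * s) + C * s * u).
  set (t := - v - y * h * r); set (w := u - y * h * s).
  assert (Hdc : d * (x * h) = A * r * t + B * (r * w + t * s) + C * s * w).
  { transitivity (h - y * h * b).
    - replace (d * (x * h)) with ((x * d) * h) by ring. replace (x * d) with (1 - y * b) by lia. ring.
    - rewrite Hb; unfold t, w, h; ring. }
  assert (Hdet1 : r * w - t * s = 1) by (rewrite <- Huv; unfold t, w; ring).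
  assert (Hprod : b * (A * t * t + 2 * B * t * w + C * w * w) = d * (d * (x * h) * (x * h) + 1)).
  { replace (d * (d * (x * h) * (x * h) + 1)) with ((d * (x * h)) * (d * (x * h)) + d * 1 * 1) by ring.
    rewrite Hdc, Hb, <- Hdet, <- Hdet1; ring. }
  assert (Hdiv : (d | A * t * t + 2 * B * t * w + C * w * w)).
  { apply Gauss with b; [|now apply rel_prime_sym].
    rewrite Hprod; apply Z.divide_factor_l. }
  destruct Hdiv as [a Ha].
  assert (Hab : b * a = d * (x * h) * (x * h) + 1).
  { apply (Z.mul_reg_l _ _ d); [lia|]. rewrite <- Hprod, Ha; ring. }
  assert (Ha0 : 0 < a).
  { pose proof (Z.mul_nonneg_nonneg d (x * h * (x * h)) ltac:(lia) (Z.square_nonneg _)).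
    assert (0 < b * a) by (rewrite Hab, <- Z.mul_assoc; lia).
    now apply (Z.mul_pos_cancel_l b a). }
  exists a, b, (x * h), r, t, s, w.
  split; [exact Hdet1|split; [exact Ha0|split; [lia|split; [exact Hb|split; [exact Hdc|]]]]].
  rewrite Ha; ring.
Qed.

(* The product of ((x, z), (z, y/d)) with the Gram matrix ((b, dc), (dc, da)) is an integral
   projector of rank one, self-adjoint for the form (b, 2dc, da); conjugating it by
   ((m1, m2), (m3, m4)) gives the projector ((al, be), (ga, 1 - al)) of the form (A, 2B, C). *)
Lemma projector_of_elliptic_class (A B C d a b c m1 m2 m3 m4 x y z : Z) :
  m1 * m4 - m2 * m3 = 1 ->
  b = A * m1 * m1 + 2 * B * m1 * m3 + C * m3 * m3 ->
  d * c = A * m1 * m2 + B * (m1 * m4 + m2 * m3) + C * m3 * m4 ->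
  d * a = A * m2 * m2 + 2 * B * m2 * m4 + C * m4 * m4 ->
  a * b - d * c * c = 1 ->
  x * y = d * z * z -> a * y + b * x + 2 * d * c * z = 1 ->
  exists al be ga,
    al * (1 - al) = be * ga /\ A * be + B * (1 - al) = B * al + C * ga.
Proof.
  intros Hm Hb Hc Ha Hpp Hiso Htr.
  set (p := b * x + d * c * z); set (q := d * (a * z + c * x)); set (r := b * z + c * y).
  set (s := a * y + d * c * z).
  assert (Hs : s = 1 - p) by (unfold s, p; lia).
  assert (Hdet : p * s = q * r).
  { unfold p, q, r, s.
    transitivity (b * a * (x * y) + (d * c * b * x * z + d * c * a * y * z) + d * c * (d * c) * z * z); [ring|].
    transitivity (a * b * (d * z * z) + (d * c * b * x * z + d * c * a * y * z) + d * c * c * (x * y)); [|ring].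
    rewrite Hiso; ring. }
  assert (Hsym : b * q + d * c * s = d * c * p + d * a * r) by (unfold p, q, r, s; ring).
  clearbody p q r s.
  exists ((m1 * p + m2 * r) * m4 - (m1 * q + m2 * s) * m3),
    (- (m1 * p + m2 * r) * m2 + (m1 * q + m2 * s) * m1),
    ((m3 * p + m4 * r) * m4 - (m3 * q + m4 * s) * m3).
  assert (E : 1 - ((m1 * p + m2 * r) * m4 - (m1 * q + m2 * s) * m3)
     = - (m3 * p + m4 * r) * m2 + (m3 * q + m4 * s) * m1).
  { transitivity ((m1 * m4 - m2 * m3) * (p + s) - ((m1 * p + m2 * r) * m4 - (m1 * q + m2 * s) * m3)); [|ring].
    rewrite Hm, Hs; ring. }
  rewrite E; split.
  - apply Z.sub_move_0_r.
    transitivity ((m1 * m4 - m2 * m3) * (m1 * m4 - m2 * m3) * (p * s - q * r)); [ring|].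
    rewrite Hdet; ring.
  - rewrite Hb, Hc, Ha in Hsym; lia.
Qed.

(** * Forms and classes that admit no splitting *)

(** Put t = 1 - 2 al; then t^2 = 1 - 4 be ga and B t = C ga - A be. If be ga = 0, then A or C
    divides B, which is too small. Otherwise [be] and [ga] have opposite signs, and A, C > 2B give
    |t| > 2 (|be| + |ga|), against t^2 = 1 + 4 |be ga|. *)
Lemma generic_form_no_projector (A B C al be ga : Z) :
  0 < B -> 2 * B < A -> A < C ->
  al * (1 - al) = be * ga -> A * be + B * (1 - al) = B * al + C * ga -> False.
Proof.
  intros HB HA HC H1 H2.
  set (t := 1 - 2 * al).
  assert (Ht : t * t = 1 - 4 * (be * ga)) by (unfold t; rewrite <- H1; ring).
  assert (HBt : B * t = C * ga - A * be) by (unfold t; lia).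
  clearbody t; clear H1 H2 al.
  assert (Hsmall : forall D u, B < D -> B <> D * u /\ - B <> D * u).
  { intros D u HD; destruct (Z.lt_trichotomy u 0) as [Hu|[-> |Hu]]; [|lia|]; nia. }
  destruct (Z.eq_dec be 0) as [->|Hbe].
  { destruct (Hsmall C ga); [lia|].
    destruct (Z.mul_eq_1 t t) as [-> | ->]; lia. }
  destruct (Z.eq_dec ga 0) as [->|Hga].
  { destruct (Hsmall A (- be)); [lia|].
    destruct (Z.mul_eq_1 t t) as [-> | ->]; lia. }
  assert (Hneg : be * ga < 0) by nia.
  assert (Hw : exists n m, 0 < n /\ 0 < m /\ t * t = 1 + 4 * (n * m) /\ A * n + C * m <= B * Z.abs t).
  { destruct (Z.lt_ge_cases 0 be).
    - exists be, (- ga); repeat split; nia.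
    - exists (- be), ga; repeat split; nia. }
  destruct Hw as (n & m & Hn & Hm & Htt & Hle).
  assert (2 * (n + m) < Z.abs t) by nia.
  assert (Z.abs t * Z.abs t = 1 + 4 * (n * m)) by nia.
  nia.
Qed.

(** This concerns the form (4, 4, 2k + 1) of determinant 8k. Parity gives ga = 2g, and eliminating
    [be] leaves u (u - 1) + 2k g^2 = 0 with u = al + g. Both terms are nonnegative, so g = 0, and 2
    be = 2 al - 1 is absurd. *)
Lemma divisible_by_8_form_no_projector (k al be ga : Z) :
  0 < k ->
  al * (1 - al) = be * ga -> 4 * be + 2 * (1 - al) = 2 * al + (2 * k + 1) * ga -> False.
Proof.
  intros Hk H1 H2.
  assert (exists g, ga = 2 * g) as [g ->].
  { exists (2 * be + 1 - 2 * al - k * ga); lia. }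
  assert (Hg : 2 * be = (2 * k + 1) * g - 1 + 2 * al) by lia.
  assert (H3 : (al + g) * (al + g) - (al + g) + 2 * k * (g * g) = 0).
  { replace (be * (2 * g)) with ((2 * be) * g) in H1 by ring. rewrite Hg in H1. nia. }
  destruct (Z.eq_dec g 0) as [->|Hg0]; [lia|].
  assert (0 <= (al + g) * (al + g) - (al + g)) 
    by (clear; destruct (Z.lt_ge_cases 0 (al + g)); nia).
  assert (0 < 2 * k * (g * g)) by (clear - Hk Hg0; nia).
  lia.
Qed.

(** Eliminating [y] gives d (2z - x)^2 = x (2 - x) <= 1. Hence x = 2z is 0 or 2, and 2y is 1 or the
    odd number d. *)
Lemma odd_degree_no_elliptic_class (d b x y z : Z) :
  1 < d -> d mod 2 = 1 -> 2 * b = 1 + d ->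
  x * y = d * z * z -> 2 * y + b * x - 2 * d * z = 1 -> False.
Proof.
  intros Hd Hodd Hb Hiso Htr.
  assert (H : d * ((2 * z - x) * (2 * z - x)) = x * (2 - x)).
  { assert (E : 4 * (x * y) + 2 * b * x * x - 4 * d * z * x = 2 * x).
    { transitivity (2 * x * (2 * y + b * x - 2 * d * z)); [ring|rewrite Htr; ring]. }
    rewrite Hiso, Hb in E. lia. }
  assert (Hx : x * (2 - x) <= 1) by nia.
  assert (Hzx : 2 * z - x = 0).
  { destruct (Z.eq_dec (2 * z - x) 0) as [E|E]; [exact E|exfalso].
    assert (1 <= (2 * z - x) * (2 * z - x)) by nia. nia. }
  rewrite Hzx in H.
  assert (x = 0 \/ x = 2) as [-> | ->] by nia; [lia|].
  assert (z = 1) as -> by lia.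
  assert (d = 2 * y) by lia. subst d. rewrite Z.mul_comm, Z.mod_mul in Hodd; lia.
Qed.

(** * Reduction of forms and idoneal numbers *)

(** Gauss reduction, by induction on the leading coefficient: translate to make the middle
    coefficient small, then swap if the last coefficient is below the first. The reducing basis is
    (p, q), (r, s). *)
Lemma form_reduction (a h k : Z) :
  0 < a -> 0 < a * k - h * h ->
  exists p r q s,
    p * s - r * q = 1 /\
    (let A := a * p * p + 2 * h * p * q + k * q * q in
     let B := a * p * r + h * (p * s + q * r) + k * q * s in
     let C := a * r * r + 2 * h * r * s + k * s * s in
     0 < A /\ 2 * Z.abs B <= A /\ A <= C).
Proof.
  intros Ha; revert h k.
  refine (Zlt_lower_bound_ind (fun a => forall h k, 0 < a * k - h * h -> exists p r q s,
    p * s - r * q = 1 /\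
    (let A := a * p * p + 2 * h * p * q + k * q * q in
     let B := a * p * r + h * (p * s + q * r) + k * q * s in
     let C := a * r * r + 2 * h * r * s + k * s * s in
     0 < A /\ 2 * Z.abs B <= A /\ A <= C)) 1 _ a _); [|lia].
  clear a Ha; intros a IH Ha h k Hdet.
  (* [- n] is h / a rounded to a nearest integer. *)
  set (n := - ((2 * h + a) / (2 * a))).
  assert (Hn : 2 * Z.abs (h + n * a) <= a).
  { pose proof (Z.div_mod (2 * h + a) (2 * a) ltac:(lia)).
    pose proof (Z.mod_pos_bound (2 * h + a) (2 * a) ltac:(lia)).
    unfold n; lia. }
  clearbody n.
  set (k' := a * n * n + 2 * h * n + k).
  assert (Hk' : 0 < k').
  { assert (H : 0 < a * k').
    { replace (a * k') with ((h + n * a) * (h + n * a) + (a * k - h * h)) by (unfold k'; ring).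
      pose proof (Z.square_nonneg (h + n * a)); lia. }
    now apply (Z.mul_pos_cancel_l a k'); [lia|]. }
  destruct (Z.lt_ge_cases k' a) as [Hlt|Hge].
  - destruct (IH k' ltac:(lia) (- (h + n * a)) a) as (p & r & q & s & H1 & H2).
    { replace (k' * a - - (h + n * a) * - (h + n * a)) with (a * k - h * h); [exact Hdet|].
      unfold k'; ring. }
    exists (n * p - q), (n * r - s), p, r; split; [lia|].
    cbv zeta in H2 |- *. destruct H2 as (HA & HB & HC).
    match goal with |- 0 < ?A' /\ 2 * Z.abs ?B' <= _ /\ _ <= ?C' =>
      match type of HA with 0 < ?A0 => replace A' with A0 by (unfold k'; ring) end;
      match type of HB with 2 * Z.abs ?B0 <= _ => replace B' with B0 by (unfold k'; ring) end;
      match type of HC with _ <= ?C0 => replace C' with C0 by (unfold k'; ring) end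
    end.
    auto.
  - exists 1, n, 0, 1; split; [ring|]; cbv zeta.
    replace (a * 1 * 1 + 2 * h * 1 * 0 + k * 0 * 0) with a by ring.
    replace (a * 1 * n + h * (1 * 1 + 0 * n) + k * 0 * 1) with (h + n * a) by ring.
    replace (a * n * n + 2 * h * n * 1 + k * 1 * 1) with k' by (unfold k'; ring).
    lia.
Qed.

Definition idonealZ (d : Z) : Prop :=
  forall B A C, 1 <= B -> 3 * (B * B) <= d -> d + B * B = A * C -> 2 * B <= A -> A <= C ->
    primitive_form A B C -> A = C \/ A = 2 * B.

Lemma divide_of_nat (a b : nat) : Nat.divide a b <-> (Z.of_nat a | Z.of_nat b).
Proof.
  split; [intros [k ->]; exists (Z.of_nat k); lia|intros [k Hk]].
  destruct (Z.le_gt_cases 0 k) as [H|H].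
  - exists (Z.to_nat k); apply Nat2Z.inj; rewrite Nat2Z.inj_mul, Z2Nat.id; lia.
  - exists 0%nat; nia.
Qed.

Lemma gcd_primitive_form (A B C : nat) :
  Nat.gcd (Nat.gcd A (2 * B)) C = 1%nat <->
  primitive_form (Z.of_nat A) (Z.of_nat B) (Z.of_nat C).
Proof.
  unfold primitive_form; replace (2 * Z.of_nat B) with (Z.of_nat (2 * B)) by lia; split.
  - intros H l Hl HA HB HC; pose proof (prime_ge_2 l Hl).
    rewrite <- (Z2Nat.id l) in * by lia.
    apply divide_of_nat in HA, HB, HC.
    assert (Hd : Nat.divide (Z.to_nat l) 1) by (rewrite <- H; auto using Nat.gcd_greatest).
    apply Nat.divide_1_r in Hd; lia.
  - intros H; set (g := Nat.gcd _ C).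
    assert (Hg : Z.gcd (Z.of_nat g) (Z.of_nat g) = 1); [|rewrite Z.gcd_diag in Hg; lia].
    apply Zgcd_1_rel_prime, rel_prime_of_no_common_prime; intros l Hl Hd _.
    apply (H l Hl); (eapply Z.divide_trans; [exact Hd|]); apply divide_of_nat;
      unfold g; eauto using Nat.divide_trans, Nat.gcd_divide_l, Nat.gcd_divide_r.
Qed.

Lemma idoneal_iff_idonealZ (d : nat) : (1 <= d)%nat -> idoneal d <-> idonealZ (Z.of_nat d).
Proof.
  intros Hd; split.
  - intros [_ H] B A C HB HBd HAC HBA HCA Hp.
    rewrite <- (Z2Nat.id A), <- (Z2Nat.id B), <- (Z2Nat.id C) in * by lia.
    set (A' := Z.to_nat A) in *; set (B' := Z.to_nat B) in *; set (C' := Z.to_nat C) in *.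
    destruct (H B' A' C'); try lia.
    apply gcd_primitive_form, Hp.
  - intros H; split; [exact Hd|]; intros B A C HB HBd HAC HBA HCA Hp.
    destruct (H (Z.of_nat B) (Z.of_nat A) (Z.of_nat C)); try lia.
    now apply gcd_primitive_form.
Qed.

(** If B were nonzero, reducedness would give 3 B^2 <= d, so idoneality leaves A = C or A = 2|B|,
    and primitivity makes A or C odd. As d is even, either d = A^2 - B^2 with A and B odd, or d =
    |B| (2C - |B|) with B even and C odd; in both cases 8 divides d. *)
Lemma idoneal_reduced_form_diagonal (d A B C : Z) :
  d mod 8 = 2 \/ d mod 8 = 4 \/ d mod 8 = 6 -> idonealZ d ->
  A * C - B * B = d -> 2 * Z.abs B <= A -> A <= C -> primitive_form A B C -> B = 0.
Proof.
  intros Hmod Hid Hdet HBA HAC Hprim.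
  destruct (Z.eq_dec B 0) as [HB|HB]; [exact HB|exfalso].
  remember (Z.abs B) as b eqn:Hb.
  assert (Hbb : b * b = B * B) by (subst b; lia).
  assert (Hb1 : 1 <= b) by lia.
  assert (Hprim' : primitive_form A b C).
  { intros l Hl HA HB' HC; apply (Hprim l Hl HA); [|exact HC].
    destruct (Z.abs_eq_or_opp B) as [E|E]; rewrite E in Hb; subst b; [exact HB'|].
    replace (2 * B) with (- (2 * - B)) by ring. now apply Z.divide_opp_r. }
  assert (Hodd : exists i, C = 2 * i + 1 \/ A = 2 * i + 1).
  { destruct (Zeven_odd_dec C) as [HC|HC];
    destruct (Zeven_odd_dec A) as [HA|HA];
    apply Zeven_ex_iff in HC || apply Zodd_ex_iff in HC;
    apply Zeven_ex_iff in HA || apply Zodd_ex_iff in HA;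
    destruct HC as [i Hi], HA as [j Hj]; try (exists i; lia); try (exists j; lia).
    exfalso; apply (Hprim' 2 prime_2); [exists j; lia|exists b; ring|exists i; lia]. }
  assert (Hpar : forall u, exists v, u * (u + 1) = 2 * v).
  { intros u; destruct (Z.Even_or_Odd u) as [[v ->]|[v ->]].
    - exists (v * (2 * v + 1)); ring.
    - exists ((2 * v + 1) * (v + 1)); ring. }
  assert (Hd2 : exists w, d = 2 * w).
  { exists (d / 2); Z.to_euclidean_division_equations; lia. }
  destruct Hd2 as [w Hw].
  assert (Hd8 : exists u, d = 8 * u); [|destruct Hd8 as [u Hu]; Z.to_euclidean_division_equations; lia].
  destruct (Hid b A C) as [E|E]; try lia; [nia|exact Hprim'| |].
  - subst C; destruct Hodd as [i Hi].
    assert (Hi' : A = 2 * i + 1) by lia.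
    assert (exists j, b = 2 * j + 1) as [j Hj].
    { destruct (Z.Even_or_Odd b) as [[v Hv]|Hv]; [|exact Hv].
      exfalso; rewrite <- Hbb, Hi', Hv in Hdet; lia. }
    destruct (Hpar i) as [u Hu], (Hpar j) as [v Hv].
    exists (u - v); rewrite Hi', <- Hbb, Hj in Hdet; lia.
  - destruct Hodd as [i Hi]. assert (Hi' : C = 2 * i + 1) by lia.
    assert (exists j, b = 2 * j) as [j Hj].
    { destruct (Z.Even_or_Odd b) as [Hv|[v Hv]]; [exact Hv|].
      exfalso; rewrite <- Hbb, E, Hv, Hi' in Hdet. lia. }
    destruct (Hpar j) as [u Hu].
    exists (j * i - u + j). rewrite <- Hbb, E, Hj, Hi' in Hdet. lia.
Qed.

(** A basis (P, q), (R, s) diagonalizing (b, 2dc, da) yields a splitting of (a, b, c) into the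
    isotropic classes (e p^2, f q^2, -pq) and (f r^2, e s^2, -rs). *)
Lemma diagonal_polarization (d a b c e f P q R s : Z) :
  e * f = d -> a * b - d * c * c = 1 -> rel_prime e f -> 0 < e -> 0 < f ->
  P * s - R * q = 1 ->
  b * P * P + 2 * (d * c) * P * q + d * a * q * q = e ->
  b * P * R + d * c * (P * s + q * R) + d * a * q * s = 0 ->
  b * R * R + 2 * (d * c) * R * s + d * a * s * s = f ->
  exists p r,
    e * p * s - f * r * q = 1 /\
    a = e * p * p + f * r * r /\ b = f * q * q + e * s * s /\ c = - (p * q + r * s).
Proof.
  intros Hd Hpp Hef He Hf Hdet H1 H2 H3.
  destruct (rel_prime_bezout _ _ Hef) as [u v Huv].
  (* Modulo [e] the orthogonality relation reads b P R = 0. There [b] is invertible because a b = 1,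
     and [R] because the value [f] at (R, s) is prime to [e]. The argument for [f] and [R] is
     symmetric. *)
  assert (HeP : (e | P)).
  { apply Gauss with R; [apply Gauss with b|].
    - exists (- f * (c * (P * s + q * R) + a * q * s)).
      transitivity (- (d * (c * (P * s + q * R) + a * q * s))); [lia|rewrite <- Hd; ring].
    - apply bezout_rel_prime; exists (- f * c * c) a; rewrite <- Hpp, <- Hd; ring.
    - apply bezout_rel_prime; exists (u + v * f * a * s * s) (v * (b * R + 2 * d * c * s)).
      transitivity (u * e + v * (b * R * R + 2 * (d * c) * R * s + d * a * s * s));
        [rewrite <- Hd; ring|rewrite H3; exact Huv]. }
  assert (HfR : (f | R)).
  { apply Gauss with P; [apply Gauss with b|].
    - exists (- e * (c * (P * s + q * R) + a * q * s)).
      transitivity (- (d * (c * (P * s + q * R) + a * q * s))); [lia|rewrite <- Hd; ring].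
    - apply bezout_rel_prime; exists (- e * c * c) a; rewrite <- Hpp, <- Hd; ring.
    - apply bezout_rel_prime; exists (v + u * e * a * q * q) (u * (b * P + 2 * d * c * q)).
      transitivity (u * (b * P * P + 2 * (d * c) * P * q + d * a * q * q) + v * f);
        [rewrite <- Hd; ring|rewrite H1; exact Huv]. }
  destruct HeP as [p ->], HfR as [r ->].
  assert (D : e * p * s - f * r * q = 1) by lia.
  assert (E1 : b * e * p * p + 2 * e * f * c * p * q + a * f * q * q = 1).
  { apply (Z.mul_reg_l _ _ e); [lia|]. rewrite <- Hd in H1. lia. }
  assert (E2 : b * f * r * r + 2 * e * f * c * r * s + a * e * s * s = 1).
  { apply (Z.mul_reg_l _ _ f); [lia|]. rewrite <- Hd in H3. lia. }
  assert (E3 : b * p * r + c * (e * p * s + f * r * q) + a * q * s = 0).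
  { apply (Z.mul_reg_l _ _ (e * f)); [lia|]. rewrite <- Hd in H2. lia. }
  (* Multiplied by the squared determinant, a, b and c become combinations of the left sides of
     [E1], [E2], [E3]; this inverts the change of basis. *)
  assert (D2 : (e * p * s - f * r * q) * (e * p * s - f * r * q) = 1) by (rewrite D; ring).
  exists p, r; split; [exact D|split; [|split]].
  - transitivity (a * ((e * p * s - f * r * q) * (e * p * s - f * r * q))); [rewrite D2; ring|].
    transitivity (f * r * r * (b * e * p * p + 2 * e * f * c * p * q + a * f * q * q)
      + e * p * p * (b * f * r * r + 2 * e * f * c * r * s + a * e * s * s)
      - 2 * e * f * p * r * (b * p * r + c * (e * p * s + f * r * q) + a * q * s)); [ring|].
    rewrite E1, E2, E3; ring.
  - transitivity (b * ((e * p * s - f * r * q) * (e * p * s - f * r * q))); [rewrite D2; ring|].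
    transitivity (e * s * s * (b * e * p * p + 2 * e * f * c * p * q + a * f * q * q)
      + f * q * q * (b * f * r * r + 2 * e * f * c * r * s + a * e * s * s)
      - 2 * e * f * q * s * (b * p * r + c * (e * p * s + f * r * q) + a * q * s)); [ring|].
    rewrite E1, E2, E3; ring.
  - transitivity (c * ((e * p * s - f * r * q) * (e * p * s - f * r * q))); [rewrite D2; ring|].
    transitivity (- r * s * (b * e * p * p + 2 * e * f * c * p * q + a * f * q * q)
      - p * q * (b * f * r * r + 2 * e * f * c * r * s + a * e * s * s)
      + (e * p * s + f * r * q) * (b * p * r + c * (e * p * s + f * r * q) + a * q * s)); [ring|].
    rewrite E1, E2, E3; ring.
Qed.

Lemma idoneal_polarization_splits (d a b c : Z) :
  0 < d -> d = 1 \/ idonealZ d /\ (d mod 8 = 2 \/ d mod 8 = 4 \/ d mod 8 = 6) ->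
  0 < a -> a * b - d * c * c = 1 ->
  exists e f p q r s,
    0 < e /\ 0 < f /\ e * f = d /\ e * p * s - f * r * q = 1 /\
    a = e * p * p + f * r * r /\ b = f * q * q + e * s * s /\ c = - (p * q + r * s).
Proof.
  intros Hd Hcase Ha Hpp.
  assert (Hb : 0 < b).
  { apply (Z.mul_pos_cancel_l a b); [exact Ha|].
    pose proof (Z.mul_nonneg_nonneg d (c * c) ltac:(lia) (Z.square_nonneg _)). lia. }
  assert (Hdisc : b * (d * a) - d * c * (d * c) = d).
  { transitivity (d * (a * b - d * c * c)); [ring|rewrite Hpp; ring]. }
  destruct (form_reduction b (d * c) (d * a) Hb) as (P & R & q & s & Hdet & HA & HB & HC); [lia|].
  match type of HA with 0 < ?x => remember x as A eqn:EA end.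
  match type of HB with 2 * Z.abs ?x <= _ => remember x as B eqn:EB end.
  match type of HC with _ <= ?x => remember x as C eqn:EC end.
  assert (Hdet' : A * C - B * B = d).
  { rewrite <- Hdisc.
    transitivity ((P * s - R * q) * (P * s - R * q) * (b * (d * a) - d * c * (d * c)));
      [rewrite EA, EB, EC; ring|rewrite Hdet; ring]. }
  assert (HBef : B = 0 /\ rel_prime A C).
  { destruct Hcase as [H1|[Hid Hmod]].
    - assert (HB0 : B = 0) by nia.
      assert (HA1 : A = 1) by nia.
      split; [exact HB0|rewrite HA1; apply rel_prime_1].
    (* A common prime of A, 2B, C divides b and 2dc, hence 2 (a b - d c^2) = 2; but b and d cannot
       both be even. *)
    - assert (Hprim : primitive_form A B C).
      { intros l Hl [x Hx] [y Hy] [z Hz].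
        assert (Hlb : b = l * (x * s * s - y * s * q + z * q * q)).
        { transitivity (A * s * s - (2 * B) * s * q + C * q * q);
            [|rewrite Hx, Hy, Hz; ring].
          transitivity ((P * s - R * q) * (P * s - R * q) * b); [rewrite Hdet; ring|].
          rewrite EA, EB, EC; ring. }
        assert (Hlh : 2 * (d * c) = l * (- (2 * x * s * R) + y * (P * s + q * R) - 2 * z * P * q)).
        { transitivity (- (2 * A * s * R) + (2 * B) * (P * s + q * R) - 2 * C * P * q);
            [|rewrite Hx, Hy, Hz; ring].
          transitivity ((P * s - R * q) * (P * s - R * q) * (2 * (d * c))); [rewrite Hdet; ring|].
          rewrite EA, EB, EC; ring. }
        assert (Hl2 : (l | 2)).
        { exists (2 * a * (x * s * s - y * s * q + z * q * q)
            - c * (- (2 * x * s * R) + y * (P * s + q * R) - 2 * z * P * q)).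
          transitivity (2 * a * b - c * (2 * (d * c))); [lia|].
          rewrite Hlh at 1; rewrite Hlb at 1; ring. }
        assert (l = 2) as -> by (apply prime_div_prime; auto using prime_2).
        set (w := x * s * s - y * s * q + z * q * q) in *; clearbody w; subst b.
        assert (exists w', d = 2 * w') as [w' Hw'].
        { exists (d / 2); Z.to_euclidean_division_equations; lia. }
        rewrite Hw' in Hpp; lia. }
      assert (HB0 : B = 0) by (eapply idoneal_reduced_form_diagonal; eauto).
      split; [exact HB0|].
      apply rel_prime_of_no_common_prime; intros l Hl HlA HlC; apply (Hprim l Hl HlA); [|exact HlC].
      rewrite HB0; apply Z.divide_0_r. }
  destruct HBef as [-> Hrel].
  destruct (diagonal_polarization d a b c A C P q R s) as (p & r & H1 & H2 & H3 & H4);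
    try lia; [exact Hrel|].
  exists A, C, p, q, r, s; repeat split; lia.
Qed.

(** * Existence of non-split polarizations *)

Lemma nonsplit_polarization_of_form (A B C d : Z) :
  0 < d -> 0 < A -> A * C - B * B = d -> primitive_form A B C ->
  (forall al be ga, al * (1 - al) = be * ga -> A * be + B * (1 - al) = B * al + C * ga -> False) ->
  exists a b c, 0 < a /\ a * b - d * c * c = 1 /\
    forall x y z, x * y = d * z * z -> a * y + b * x - 2 * d * c * z = 1 -> False.
Proof.
  intros Hd HA Hdet Hprim Hproj.
  destruct (polarization_of_form A B C d Hd HA Hdet Hprim)
    as (a & b & c & m1 & m2 & m3 & m4 & Hm & Ha & Hpp & Eb & Ec & Ea).
  exists a, b, c; split; [exact Ha|split; [exact Hpp|intros x y z Hiso Htr]].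
  (* The intersection number contains -2dcz and the trace of the projector +2dcz, hence [- z]. *)
  destruct (projector_of_elliptic_class A B C d a b c m1 m2 m3 m4 x y (- z))
    as (al & be & ga & H1 & H2); try lia.
  exact (Hproj al be ga H1 H2).
Qed.

Lemma nonsplit_polarization_exists (d : Z) :
  0 < d -> d <> 1 -> ~ (idonealZ d /\ (d mod 8 = 2 \/ d mod 8 = 4 \/ d mod 8 = 6)) ->
  exists a b c, 0 < a /\ a * b - d * c * c = 1 /\
    forall x y z, x * y = d * z * z -> a * y + b * x - 2 * d * c * z = 1 -> False.
Proof.
  intros Hd Hd1 Hnot.
  destruct (Z.Even_or_Odd d) as [[j Hj]|[j Hj]].
  - destruct (Z.eq_dec (d mod 8) 0) as [H8|H8].
    + assert (exists k, d = 8 * k) as [k Hk].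
      { exists (d / 8); Z.to_euclidean_division_equations; lia. }
      apply (nonsplit_polarization_of_form 4 2 (2 * k + 1)); try lia.
      * intros l Hl H4 _ H.
        assert (Hl2 : (l | 2)).
        { change 4 with (2 * 2) in H4; destruct (prime_mult l Hl _ _ H4); assumption. }
        assert (l = 2) as -> by (apply prime_div_prime; auto using prime_2).
        destruct H as [u Hu]; lia.
      * intros al be ga; apply divisible_by_8_form_no_projector; lia.
    + assert (Hid : ~ idonealZ d).
      { intros Hid; apply Hnot; split; [exact Hid|].
        Z.to_euclidean_division_equations; lia. }
      (* A triple violating the criterion is itself a form without projector. *)
      apply NNPP; intros Hno; apply Hid; intros B A C HB _ HAC HBA HCA Hprim.
      destruct (Z.eq_dec A C) as [E|E]; [now left|].
      destruct (Z.eq_dec A (2 * B)) as [E'|E']; [now right|exfalso; apply Hno].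
      apply (nonsplit_polarization_of_form A B C); try lia; [exact Hprim|].
      intros al be ga; apply generic_form_no_projector; lia.
  - exists 2, (j + 1), 1; split; [lia|split; [lia|intros x y z H1 H2]].
    apply (odd_degree_no_elliptic_class d (j + 1) x y z); try lia.
    rewrite Hj, Z.add_comm, Z.mul_comm, Z.mod_add; [reflexivity|lia].
Qed.

(* In terms of the linear map N whose matrix has rows (a, b), (c, e): there are oriented bases
   (f1, f2) and (g1, g2) of Z^2 with N f1 = g1 and N f2 = d g2. *)
Lemma smith_normal_form (a b c e d : Z) :
  0 < d -> a * e - b * c = d ->
  (forall l, prime l -> (l | a) -> (l | b) -> (l | c) -> (l | e) -> False) ->
  exists f11 f12 f21 f22 g11 g12 g21 g22,
    f11 * f22 - f12 * f21 = 1 /\ g11 * g22 - g12 * g21 = 1 /\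
    g11 = f11 * a + f12 * c /\ g12 = f11 * b + f12 * e /\
    d * g21 = f21 * a + f22 * c /\ d * g22 = f21 * b + f22 * e.
Proof.
  intros Hd Hdet Hprim.
  (* [t] is chosen so that the image of f1 = (1, t) is primitive. A prime dividing both coordinates
     divides the determinant, so only the primes dividing [d] matter. *)
  destruct (chinese_remainder_primes (fun l t => ~ ((l | a + t * c) /\ (l | b + t * e))) d)
    as (t & Ht); [|exact Hd| |].
  - intros l t k Hn [H1 H2]; apply Hn; split.
    + revert H1; apply (divide_shift l _ _ (k * c)); ring.
    + revert H2; apply (divide_shift l _ _ (k * e)); ring.
  - intros l Hl _.
    destruct (classic ((l | a) /\ (l | b))) as [[[u Hu] [v Hv]]|Hn].
    + exists 1; intros [[u' Hu'] [v' Hv']]; apply (Hprim l Hl).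
      * now exists u.
      * now exists v.
      * exists (u' - u); lia.
      * exists (v' - v); lia.
    + exists 0; now rewrite !Z.mul_0_l, !Z.add_0_r.
  - assert (Hrel : rel_prime (a + t * c) (b + t * e)).
    { apply rel_prime_of_no_common_prime; intros l Hl [u Hu] [v Hv]; apply (Ht l Hl).
      - exists (e * u - c * v). rewrite <- Hdet.
        transitivity (e * (a + t * c) - c * (b + t * e)); [ring|rewrite Hu, Hv; ring].
      - split; [now exists u|now exists v]. }
    destruct (rel_prime_bezout _ _ Hrel) as [u v Huv].
    (* Here g2 = (-v, u) completes g1 by Bezout, and f2 = (0, 1) - x f1, with [x] such that the
       image (c, e) - x g1 equals d g2. *)
    set (x := c * u + e * v).
    exists 1, t, (- x), (1 - x * t), (a + t * c), (b + t * e), (- v), u.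
    repeat split; try lia.
    + rewrite <- Hdet; unfold x.
      transitivity (c * (u * (a + t * c) + v * (b + t * e)) - (c * u + e * v) * (a + t * c)); [ring|].
      rewrite Huv; ring.
    + rewrite <- Hdet; unfold x.
      transitivity (e * (u * (a + t * c) + v * (b + t * e)) - (c * u + e * v) * (b + t * e)); [ring|].
      rewrite Huv; ring.
Qed.

Close Scope Z_scope.
Open Scope R_scope.

(** * Homomorphisms of period lattices and the Néron–Severi group *)

Lemma C_ext (z w : C) : Re z = Re w -> Im z = Im w -> z = w.
Proof. destruct z, w; simpl; congruence. Qed.

(* The wedge product of the class with the holomorphic 2-form vanishes. *)
Lemma isNS_iff_holomorphic_relation (tau1 tau2 : C) (A : Alt) :
  0 < Im tau1 -> 0 < Im tau2 ->
  isNS tau1 tau2 A <->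
  Cplus (CofZ (a24 A)) (Cmult (CofZ (a13 A)) (Cmult tau1 tau2)) =
  Cplus (Cmult (CofZ (a14 A)) tau1) (Cmult (CofZ (a23 A)) tau2).
Proof.
  destruct tau1 as [s1 t1], tau2 as [s2 t2]; simpl; intros Ht1 Ht2.
  unfold isNS, formC2, evalAlt, coords, mulI, CofZ, Re, Im, Cplus, Cmult, RtoC; simpl.
  split.
  - intros H.
    (* These two pairs of vectors give the real and the imaginary part of the relation. *)
    pose proof (H ((1, 0), (0, 0)) ((0, 0), (1, 0))) as H1.
    pose proof (H ((1, 0), (0, 0)) ((0, 0), (0, 1))) as H2.
    simpl in H1, H2; clear H. 
    apply C_ext; simpl.
    + match type of H1 with ?l = ?r => apply Rminus_diag_uniq;
        transitivity (t1 * t2 * (l - r)); [field; lra|rewrite H1; ring] end.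
    + match type of H2 with ?l = ?r => apply Rminus_diag_uniq;
        transitivity (t1 * t2 * (l - r)); [field; lra|rewrite H2; ring] end.
  - intros H [[p1 q1] [p2 q2]] [[p1' q1'] [p2' q2']].
    injection H; simpl; intros H2 H1.
    assert (E4 : IZR (a14 A) = (IZR (a13 A) * (s1 * t2 + t1 * s2) - IZR (a23 A) * t2) / t1) by (field_simplify_eq; lra).
    assert (E24 : IZR (a24 A) = IZR (a14 A) * s1 + IZR (a23 A) * s2 - IZR (a13 A) * (s1 * s2 - t1 * t2)) by lra.
    rewrite E24, E4; field; lra.
Qed.

(** The matrix with rows (a, b), (c, e) describes multiplication by a + b tau2 on the lattices. Zero
    is allowed, so these matrices form the group Hom(E_tau1, E_tau2). *)
Definition lattice_hom (tau1 tau2 : C) (a b c e : Z) : Prop :=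
  Cmult (Cplus (CofZ a) (Cmult (CofZ b) tau2)) tau1 = Cplus (CofZ c) (Cmult (CofZ e) tau2).

Lemma lattice_hom_iff (s1 t1 s2 t2 : R) (a b c e : Z) :
  lattice_hom (s1, t1) (s2, t2) a b c e <->
  (IZR a + IZR b * s2) * s1 - IZR b * t2 * t1 = IZR c + IZR e * s2 /\
  (IZR a + IZR b * s2) * t1 + IZR b * t2 * s1 = IZR e * t2.
Proof.
  unfold lattice_hom, CofZ, Cmult, Cplus, RtoC; simpl; split.
  - intros H; injection H; intros H2 H1; split; lra.
  - intros [H1 H2]; apply C_ext; simpl; lra.
Qed.

(** Both sides are the area spanned by alpha and alpha tau1, where alpha = a + b tau2: determinant
    times covolume, and |alpha|^2 times covolume. *)
Lemma lattice_hom_norm (s1 t1 s2 t2 : R) (a b c e : Z) :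
  lattice_hom (s1, t1) (s2, t2) a b c e ->
  t2 * IZR (a * e - b * c) =
  ((IZR a + IZR b * s2) * (IZR a + IZR b * s2) + (IZR b * t2) * (IZR b * t2)) * t1.
Proof.
  intros H; apply lattice_hom_iff in H as [H1 H2].
  rewrite minus_IZR, !mult_IZR.
  transitivity (IZR a * (IZR e * t2) - IZR b * t2 * (IZR c + IZR e * s2) + IZR b * s2 * (IZR e * t2));
    [ring|rewrite <- H1, <- H2; ring].
Qed.

Lemma lattice_hom_det_pos (tau1 tau2 : C) (a b c e : Z) :
  0 < Im tau1 -> 0 < Im tau2 -> lattice_hom tau1 tau2 a b c e ->
  (a <> 0 \/ b <> 0)%Z -> (0 < a * e - b * c)%Z.
Proof.
  destruct tau1 as [s1 t1], tau2 as [s2 t2]; simpl; intros Ht1 Ht2 H Hab.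
  apply lt_IZR, (Rmult_lt_reg_l t2); [exact Ht2|].
  rewrite (lattice_hom_norm _ _ _ _ _ _ _ _ H), Rmult_0_r.
  apply Rmult_lt_0_compat; [|exact Ht1].
  destruct (Z.eq_dec b 0) as [->|Hb].
  - assert (IZR a <> 0) by (apply not_0_IZR; lia). nra.
  - assert (Hbt : IZR b * t2 <> 0) by (apply Rmult_integral_contrapositive_currified; [now apply not_0_IZR|lra]).
    apply Rsqr_pos_lt in Hbt; unfold Rsqr in Hbt.
    pose proof (Rle_0_sqr (IZR a + IZR b * s2)) as Hm; unfold Rsqr in Hm; lra.
Qed.

Lemma CofZ_add (m n : Z) : CofZ (m + n) = Cplus (CofZ m) (CofZ n).
Proof. unfold CofZ; rewrite plus_IZR; apply C_ext; simpl; ring. Qed.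

Lemma CofZ_mul (m n : Z) : CofZ (m * n) = Cmult (CofZ m) (CofZ n).
Proof. unfold CofZ; rewrite mult_IZR; apply C_ext; simpl; ring. Qed.

Lemma CofZ_sub (m n : Z) : CofZ (m - n) = Cminus (CofZ m) (CofZ n).
Proof. unfold CofZ; rewrite minus_IZR; apply C_ext; simpl; ring. Qed.

Lemma lattice_number_neq_0 (tau : C) (a b : Z) :
  0 < Im tau -> (a <> 0 \/ b <> 0)%Z -> Cplus (CofZ a) (Cmult (CofZ b) tau) <> RtoC 0.
Proof.
  destruct tau as [s t]; simpl; intros Ht Hab H.
  unfold CofZ, Cplus, Cmult, RtoC in H; simpl in H; injection H; intros H2 H1.
  assert (Hb : IZR b * t = 0) by lra.
  apply Rmult_integral in Hb as [Hb|Hb]; [|lra].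
  rewrite Hb in H1; apply eq_IZR_R0 in Hb.
  assert (Ha : IZR a = 0) by lra; apply eq_IZR_R0 in Ha; lia.
Qed.

(* Composing with the dual isogeny gives an endomorphism of E_tau1, an integer
   because E_tau1 has no complex multiplication. *)
Lemma lattice_hom_proportional (tau1 tau2 : C) (a0 b0 c0 e0 a b c e : Z) :
  0 < Im tau1 -> 0 < Im tau2 -> ~ hasCM tau1 ->
  lattice_hom tau1 tau2 a0 b0 c0 e0 -> (a0 <> 0 \/ b0 <> 0)%Z ->
  lattice_hom tau1 tau2 a b c e ->
  (b * a0 = a * b0 /\ c * e0 = e * c0 /\ a * e0 - b * c0 = e * a0 - c * b0)%Z.
Proof.
  intros Ht1 Ht2 HCM H0 Hab0 H.
  pose proof (lattice_number_neq_0 tau2 a0 b0 Ht2 Hab0) as Hne.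
  set (al0 := Cplus (CofZ a0) (Cmult (CofZ b0) tau2)) in *.
  (* The coordinates come from the product of the second matrix with the adjugate of the first, so
     [al] is the second multiplier times a0 e0 - b0 c0, divided by [al0]. *)
  set (al := Cplus (CofZ (a * e0 - b * c0)) (Cmult (CofZ (b * a0 - a * b0)) tau1)).
  assert (Hal : Cmult al tau1 =
    Cplus (CofZ (c * e0 - e * c0)) (Cmult (CofZ (e * a0 - c * b0)) tau1)).
  { unfold lattice_hom in H0, H; fold al0 in H0.
    set (al1 := Cplus (CofZ a) (Cmult (CofZ b) tau2)) in *.
    set (d := CofZ (a0 * e0 - b0 * c0)).
    assert (E : Cmult al al0 = Cmult d al1).
    { unfold al; transitivity (Cplus (Cmult (CofZ (a * e0 - b * c0)) al0)
        (Cmult (CofZ (b * a0 - a * b0)) (Cmult al0 tau1))); [ring|].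
      rewrite H0; unfold d, al0, al1; rewrite !CofZ_sub, !CofZ_mul; ring. }
    assert (E2 : Cmult (Cmult al tau1) al0 = Cmult (Cplus (CofZ (c * e0 - e * c0))
        (Cmult (CofZ (e * a0 - c * b0)) tau1)) al0).
    { transitivity (Cmult (Cmult al al0) tau1); [ring|].
      rewrite E; transitivity (Cmult d (Cmult al1 tau1)); [ring|].
      rewrite H; symmetry.
      transitivity (Cplus (Cmult (CofZ (c * e0 - e * c0)) al0)
        (Cmult (CofZ (e * a0 - c * b0)) (Cmult al0 tau1))); [ring|].
      rewrite H0; unfold d, al0; rewrite !CofZ_sub, !CofZ_mul; ring. }
    apply (f_equal (fun u => Cmult u (Cinv al0))) in E2.
    rewrite <- !Cmult_assoc, Cinv_r, !Cmult_1_r in E2 by exact Hne; exact E2. }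
  assert (Hz : (b * a0 - a * b0 = 0)%Z).
  { destruct (Z.eq_dec (b * a0 - a * b0) 0) as [Hz|Hz]; [exact Hz|exfalso; apply HCM].
    exists al; split; [|split].
    - unfold al, CofZ; destruct tau1 as [s1 t1]; simpl in *.
      apply not_0_IZR in Hz; nra.
    - now exists (a * e0 - b * c0)%Z, (b * a0 - a * b0)%Z.
    - now exists (c * e0 - e * c0)%Z, (e * a0 - c * b0)%Z. }
  unfold al in Hal; rewrite Hz in Hal; clearbody al0; clear - Hal Hz Ht1.
  destruct tau1 as [s1 t1]; unfold CofZ, Cplus, Cmult, RtoC in Hal; simpl in *.
  injection Hal; clear Hal; intros H2 H1.
  assert (E : IZR (a * e0 - b * c0) = IZR (e * a0 - c * b0)).
  { apply (Rmult_eq_reg_r t1); lra. }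
  assert (E' : IZR (c * e0 - e * c0) = 0) by (rewrite E in H1; lra).
  apply eq_IZR in E; apply eq_IZR_R0 in E'; lia.
Qed.

(** By proportionality D N = m N0 for every homomorphism N, where N0 has the minimal degree D. If m
    = k D + r with 0 < r < D, then N - k N0 has degree r^2 / D < D, against minimality. *)
Lemma minimal_isogeny_generates (tau1 tau2 : C) (d : nat) :
  0 < Im tau1 -> 0 < Im tau2 -> ~ hasCM tau1 ->
  minimal_isogeny_degree tau1 tau2 d ->
  exists a0 b0 c0 e0 : Z,
    lattice_hom tau1 tau2 a0 b0 c0 e0 /\
    (a0 * e0 - b0 * c0 = Z.of_nat d)%Z /\ (0 < Z.of_nat d)%Z /\
    forall a b c e, lattice_hom tau1 tau2 a b c e ->
      exists k, (a = k * a0 /\ b = k * b0 /\ c = k * c0 /\ e = k * e0)%Z.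
Proof.
  intros Ht1 Ht2 HCM [(al & a0 & b0 & c0 & e0 & Hne & Hal & Hal1 & Hdeg) Hmin].
  rewrite Hal in Hal1; change (lattice_hom tau1 tau2 a0 b0 c0 e0) in Hal1.
  assert (Hab0 : (a0 <> 0 \/ b0 <> 0)%Z).
  { destruct (Z.eq_dec a0 0) as [->|]; [|now left].
    destruct (Z.eq_dec b0 0) as [->|]; [|now right].
    exfalso; apply Hne; rewrite Hal; unfold CofZ; ring. }
  pose proof (lattice_hom_det_pos _ _ _ _ _ _ Ht1 Ht2 Hal1 Hab0) as Hpos.
  rewrite Z.abs_eq in Hdeg by lia.
  exists a0, b0, c0, e0; repeat split; try lia; [exact Hal1|].
  intros a b c e H.
  destruct (lattice_hom_proportional _ _ _ _ _ _ _ _ _ _ Ht1 Ht2 HCM Hal1 Hab0 H) as (P1 & P2 & P3).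
  set (D := Z.of_nat d) in *.
  set (m := (a * e0 - b * c0)%Z) in *.
  assert (Ea : (D * a = m * a0)%Z).
  { rewrite Hdeg; unfold m; transitivity (a * e0 * a0 - (a * b0) * c0)%Z; [ring|rewrite <- P1; ring]. }
  assert (Eb : (D * b = m * b0)%Z).
  { rewrite Hdeg; unfold m; transitivity ((b * a0) * e0 - b * b0 * c0)%Z; [ring|rewrite P1; ring]. }
  assert (Ec : (D * c = m * c0)%Z).
  { rewrite Hdeg, P3; unfold m; transitivity (a0 * (c * e0) - b0 * c0 * c)%Z; [ring|rewrite P2; ring]. }
  assert (Ee : (D * e = m * e0)%Z).
  { rewrite Hdeg, P3; unfold m; transitivity (a0 * e0 * e - b0 * (e * c0))%Z; [ring|rewrite <- P2; ring]. }
  clearbody m; clear P1 P2 P3.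
  pose proof (Z.div_mod m D ltac:(lia)) as Hm.
  pose proof (Z.mod_pos_bound m D ltac:(lia)) as Hr.
  set (k := (m / D)%Z) in *; set (r := (m mod D)%Z) in *; clearbody k r.
  destruct (Z.eq_dec r 0) as [Hr0|Hr0].
  { exists k; repeat split; apply (Z.mul_reg_l _ _ D); nia. }
  exfalso.
  assert (Ra : (D * (a - k * a0) = r * a0)%Z) by nia.
  assert (Rb : (D * (b - k * b0) = r * b0)%Z) by nia.
  assert (Rc : (D * (c - k * c0) = r * c0)%Z) by nia.
  assert (Re : (D * (e - k * e0) = r * e0)%Z) by nia.
  assert (H' : lattice_hom tau1 tau2 (a - k * a0) (b - k * b0) (c - k * c0) (e - k * e0)).
  { unfold lattice_hom in *; rewrite !CofZ_sub, !CofZ_mul.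
    transitivity (Cminus (Cmult (Cplus (CofZ a) (Cmult (CofZ b) tau2)) tau1)
      (Cmult (CofZ k) (Cmult (Cplus (CofZ a0) (Cmult (CofZ b0) tau2)) tau1))); [ring|].
    rewrite H, Hal1; ring. }
  set (a' := (a - k * a0)%Z) in *; set (b' := (b - k * b0)%Z) in *.
  set (c' := (c - k * c0)%Z) in *; set (e' := (e - k * e0)%Z) in *.
  clearbody a' b' c' e'.
  assert (Hab' : (a' <> 0 \/ b' <> 0)%Z) by nia.
  pose proof (lattice_hom_det_pos _ _ _ _ _ _ Ht1 Ht2 H' Hab') as Hpos'.
  assert (Hdet' : (D * (a' * e' - b' * c') = r * r)%Z).
  { apply (Z.mul_reg_l _ _ D); [lia|].
    transitivity ((D * a') * (D * e') - (D * b') * (D * c'))%Z; [ring|].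
    rewrite Ra, Rb, Rc, Re, Hdeg; ring. }
  assert (Hle : (d <= Z.to_nat (a' * e' - b' * c'))%nat).
  { apply Hmin; exists (Cplus (CofZ a') (Cmult (CofZ b') tau2)), a', b', c', e'.
    repeat split; [now apply lattice_number_neq_0|exact H'|lia]. }
  assert (D <= a' * e' - b' * c')%Z by lia.
  nia.
Qed.

(** * Coordinates on the Néron-Severi group, intersection numbers and ampleness *)

(* [x] and [y] are the multiplicities of the two fibre classes; the third coordinate
   multiplies the class attached to the isogeny with matrix (a0, b0, c0, e0). *)
Definition ns_class (a0 b0 c0 e0 x y k : Z) : Alt :=
  mkAlt x (- (k * b0)) (k * a0) (- (k * e0)) (k * c0) y.

Lemma intAlt_ns_class (a0 b0 c0 e0 x y k x' y' k' : Z) :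
  intAlt (ns_class a0 b0 c0 e0 x y k) (ns_class a0 b0 c0 e0 x' y' k') =
  (x * y' + y * x' - 2 * (a0 * e0 - b0 * c0) * k * k')%Z.
Proof. cbv [intAlt ns_class a12 a13 a14 a23 a24 a34]; ring. Qed.

Lemma addAlt_ns_class (a0 b0 c0 e0 x y k x' y' k' : Z) :
  addAlt (ns_class a0 b0 c0 e0 x y k) (ns_class a0 b0 c0 e0 x' y' k') =
  ns_class a0 b0 c0 e0 (x + x') (y + y') (k + k').
Proof. unfold addAlt, ns_class; simpl; f_equal; ring. Qed.

Lemma CofZ_opp (m : Z) : CofZ (- m) = Copp (CofZ m).
Proof. unfold CofZ; rewrite opp_IZR; apply C_ext; simpl; ring. Qed.

Lemma isNS_ns_class (tau1 tau2 : C) (a0 b0 c0 e0 x y k : Z) :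
  0 < Im tau1 -> 0 < Im tau2 -> lattice_hom tau1 tau2 a0 b0 c0 e0 ->
  isNS tau1 tau2 (ns_class a0 b0 c0 e0 x y k).
Proof.
  intros Ht1 Ht2 H; apply isNS_iff_holomorphic_relation; try assumption; simpl.
  rewrite !CofZ_opp, !CofZ_mul.
  transitivity (Cplus (Cmult (CofZ k) (Cplus (CofZ c0) (Cmult (CofZ e0) tau2)))
    (Cminus (Copp (Cmult (CofZ k) (Cmult (CofZ b0) (Cmult tau1 tau2))))
            (Cmult (CofZ k) (Cmult (CofZ e0) tau2)))); [ring|].
  rewrite <- H; ring.
Qed.

(** The holomorphic relation rearranges to (a14 - a13 tau2) tau1 = a24 - a23 tau2, a homomorphism of
    lattices and hence a multiple of the generator. *)
Lemma isNS_ex_ns_class (tau1 tau2 : C) (a0 b0 c0 e0 : Z) (A : Alt) :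
  0 < Im tau1 -> 0 < Im tau2 ->
  (forall a b c e, lattice_hom tau1 tau2 a b c e ->
      exists k, (a = k * a0 /\ b = k * b0 /\ c = k * c0 /\ e = k * e0)%Z) ->
  isNS tau1 tau2 A -> exists x y k, A = ns_class a0 b0 c0 e0 x y k.
Proof.
  intros Ht1 Ht2 Hgen HA; apply isNS_iff_holomorphic_relation in HA; try assumption.
  destruct (Hgen (a14 A) (- a13 A)%Z (a24 A) (- a23 A)%Z) as (k & E1 & E2 & E3 & E4).
  - unfold lattice_hom; rewrite !CofZ_opp.
    transitivity (Cminus (Cplus (Cmult (CofZ (a14 A)) tau1) (Cmult (CofZ (a23 A)) tau2))
      (Cplus (Cmult (CofZ (a23 A)) tau2) (Cmult (CofZ (a13 A)) (Cmult tau1 tau2)))); [ring|].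
    rewrite <- HA; ring.
  - exists (a12 A), (a34 A), k; destruct A; unfold ns_class; simpl in *; f_equal; lia.
Qed.

(** With alpha = m + i n and z_j = p_j + i q_j, the mixed term is 2k / t2 times the real part of
    conj(alpha z_1) z_2. *)
Lemma hermitian_form_ns_class (s1 t1 s2 t2 : R) (a0 b0 c0 e0 x y k : Z) (p1 q1 p2 q2 : R) :
  0 < t1 -> 0 < t2 -> lattice_hom (s1, t1) (s2, t2) a0 b0 c0 e0 ->
  let m := IZR a0 + IZR b0 * s2 in
  let n := IZR b0 * t2 in
  formC2 (s1, t1) (s2, t2) (ns_class a0 b0 c0 e0 x y k)
    ((p1, q1), (p2, q2)) (mulI ((p1, q1), (p2, q2))) =
  IZR x * (p1 * p1 + q1 * q1) / t1 + IZR y * (p2 * p2 + q2 * q2) / t2 +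
  2 * IZR k / t2 * (m * (p1 * p2 + q1 * q2) + n * (p1 * q2 - q1 * p2)).
Proof.
  intros Ht1 Ht2 H; apply lattice_hom_iff in H as [H1 H2].
  unfold formC2, evalAlt, coords, mulI, ns_class, Re, Im, Cmult; simpl.
  rewrite !opp_IZR, !mult_IZR.
  assert (Ee : IZR e0 = ((IZR a0 + IZR b0 * s2) * t1 + IZR b0 * t2 * s1) / t2).
  { apply (Rmult_eq_reg_r t2); [rewrite <- H2; field; lra|lra]. }
  assert (Ec : IZR c0 = (IZR a0 + IZR b0 * s2) * s1 - IZR b0 * t2 * t1 - IZR e0 * s2) by lra.
  rewrite Ec, Ee; field; lra.
Qed.

Lemma ampleNS_ns_class_iff (tau1 tau2 : C) (a0 b0 c0 e0 x y k : Z) :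
  0 < Im tau1 -> 0 < Im tau2 -> lattice_hom tau1 tau2 a0 b0 c0 e0 ->
  (x * y - (a0 * e0 - b0 * c0) * k * k = 1)%Z ->
  ampleNS tau1 tau2 (ns_class a0 b0 c0 e0 x y k) <-> (0 < x)%Z.
Proof.
  destruct tau1 as [s1 t1], tau2 as [s2 t2]; simpl Im; intros Ht1 Ht2 H Hpp; split.
  - intros Hample.
    assert (H1 : 0 < IZR x / t1).
    { specialize (Hample ((1, 0), (0, 0))).
      rewrite hermitian_form_ns_class in Hample by assumption.
      replace (IZR x / t1) with (IZR x * (1 * 1 + 0 * 0) / t1 + IZR y * (0 * 0 + 0 * 0) / t2 +
        2 * IZR k / t2 * ((IZR a0 + IZR b0 * s2) * (1 * 0 + 0 * 0) + IZR b0 * t2 * (1 * 0 - 0 * 0)))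
        by (field; lra).
      apply Hample; intros E; injection E; lra. }
    apply lt_IZR; replace (IZR x) with (IZR x / t1 * t1) by (field; lra).
    now apply Rmult_lt_0_compat.
  - intros Hx [[p1 q1] [p2 q2]] Hz; rewrite hermitian_form_ns_class by assumption; cbv zeta.
    apply lattice_hom_norm in H.
    apply IZR_lt in Hx; apply (f_equal IZR) in Hpp.
    rewrite minus_IZR, !mult_IZR in Hpp.
    set (D := IZR (a0 * e0 - b0 * c0)) in *.
    set (m := IZR a0 + IZR b0 * s2) in *; set (n := IZR b0 * t2) in *.
    set (X := IZR x) in *; set (Y := IZR y) in *; set (K := IZR k) in *.
    clearbody D m n X Y K.
    assert (HD : D = (m * m + n * n) * t1 / t2).
    { apply (Rmult_eq_reg_l t2); [rewrite H; field; lra|lra]. }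
    (* Completing the square: g1 + i g2 = X z_1 + K (t1 / t2) conj(alpha) z_2, and the remaining
       coefficient of |z_2|^2 simplifies by X Y - D K^2 = 1. *)
    set (g1 := X * p1 + K * (t1 / t2) * (m * p2 + n * q2)).
    set (g2 := X * q1 + K * (t1 / t2) * (m * q2 - n * p2)).
    match goal with |- 0 < ?h => assert (E : X * t1 * h = g1 * g1 + g2 * g2 + t1 / t2 * (p2 * p2 + q2 * q2)) end.
    { transitivity (g1 * g1 + g2 * g2 + t1 / t2 * (p2 * p2 + q2 * q2) * (X * Y - D * K * K));
        [rewrite HD; unfold g1, g2; field; lra|rewrite Hpp; ring]. }
    apply (Rmult_lt_reg_l (X * t1)); [now apply Rmult_lt_0_compat|].
    rewrite Rmult_0_r, E.
    assert (Ht : 0 < t1 / t2) by now apply Rdiv_lt_0_compat.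
    pose proof (Rle_0_sqr g1) as G1; pose proof (Rle_0_sqr g2) as G2; unfold Rsqr in G1, G2.
    destruct (Req_dec (p2 * p2 + q2 * q2) 0) as [H0|H0].
    + assert (p2 = 0 /\ q2 = 0) as [-> ->] by (split; nra).
      rewrite H0; unfold g1, g2.
      assert (Hne : p1 * p1 + q1 * q1 <> 0).
      { intros E0; apply Hz; assert (p1 = 0 /\ q1 = 0) as [-> ->] by (split; nra); reflexivity. }
      replace (_ + _) with (X * X * (p1 * p1 + q1 * q1)) by ring.
      apply Rmult_lt_0_compat; nra.
    + assert (0 < p2 * p2 + q2 * q2) by nra.
      assert (0 < t1 / t2 * (p2 * p2 + q2 * q2)) by now apply Rmult_lt_0_compat.
      lra.
Qed.

(** * Classes of elliptic curves and splittings *)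

(** Since u and v span one complex line, the 2-form dz_1 dz_2 vanishes on them, which is the
    holomorphic relation for the dual class. *)
Lemma curve_class_isNS (tau1 tau2 : C) (u v : Z4) :
  0 < Im tau1 -> 0 < Im tau2 -> elliptic_curve_basis tau1 tau2 u v ->
  isNS tau1 tau2 (curve_class u v).
Proof.
  intros Ht1 Ht2 (_ & (lam & _ & Hv) & _).
  apply isNS_iff_holomorphic_relation; try assumption.
  destruct u as [u1 u2 u3 u4], v as [v1 v2 v3 v4].
  set (U1 := Cplus (CofZ u1) (Cmult (CofZ u2) tau1)).
  set (U2 := Cplus (CofZ u3) (Cmult (CofZ u4) tau2)).
  assert (E1 : Cplus (CofZ v1) (Cmult (CofZ v2) tau1) = Cmult lam U1) by exact (f_equal fst Hv).
  assert (E2 : Cplus (CofZ v3) (Cmult (CofZ v4) tau2) = Cmult lam U2) by exact (f_equal snd Hv).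
  cbv [curve_class minor a12 a13 a14 a23 a24 a34 n1 n2 n3 n4].
  rewrite !CofZ_opp, !CofZ_sub, !CofZ_mul.
  match goal with |- _ = ?r => transitivity (Cminus r (Cminus
    (Cmult U1 (Cplus (CofZ v3) (Cmult (CofZ v4) tau2)))
    (Cmult U2 (Cplus (CofZ v1) (Cmult (CofZ v2) tau1))))) end.
  - unfold U1, U2; ring.
  - rewrite E1, E2; ring.
Qed.

Lemma intAlt_addAlt_r (A B C : Alt) : intAlt A (addAlt B C) = (intAlt A B + intAlt A C)%Z.
Proof. cbv [intAlt addAlt a12 a13 a14 a23 a24 a34]; ring. Qed.

Lemma curve_class_isotropic (u v : Z4) : intAlt (curve_class u v) (curve_class u v) = 0%Z.
Proof. cbv [intAlt curve_class minor a12 a13 a14 a23 a24 a34]; ring. Qed.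

(* In the bases of the Smith normal form the curve is the image of
   z |-> (f q z, p (isogeny z)); since the isogeny is diag(1, e f) there, the image of f2 is
   divisible by f, and v is the quotient. *)
Lemma elliptic_curve_of_splitting (tau1 tau2 : C) (a0 b0 c0 e0 e f p q r s : Z)
  (f11 f12 f21 f22 g11 g12 g21 g22 : Z) :
  0 < Im tau1 -> 0 < Im tau2 -> lattice_hom tau1 tau2 a0 b0 c0 e0 ->
  (0 < f)%Z -> (e * p * s - f * r * q = 1)%Z ->
  (f11 * f22 - f12 * f21 = 1)%Z -> (g11 * g22 - g12 * g21 = 1)%Z ->
  (g11 = f11 * a0 + f12 * c0)%Z -> (g12 = f11 * b0 + f12 * e0)%Z ->
  (e * f * g21 = f21 * a0 + f22 * c0)%Z -> (e * f * g22 = f21 * b0 + f22 * e0)%Z ->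
  exists u v : Z4, elliptic_curve_basis tau1 tau2 u v /\
    curve_class u v = ns_class a0 b0 c0 e0 (e * p * p) (f * q * q) (- (p * q)).
Proof.
  intros Ht1 Ht2 Hhom Hf Hbez Hdf Hdg Hg11 Hg12 Hg21 Hg22.
  set (u := mkZ4 (f * q * f11) (f * q * f12) (p * g11) (p * g12)).
  set (v := mkZ4 (q * f21) (q * f22) (e * p * g21) (e * p * g22)).
  assert (Hclass : curve_class u v = ns_class a0 b0 c0 e0 (e * p * p) (f * q * q) (- (p * q))).
  { unfold curve_class, minor, ns_class, u, v; simpl n1; simpl n2; simpl n3; simpl n4.
    f_equal.
    - transitivity (e * p * p * (g11 * g22 - g12 * g21))%Z; [ring|rewrite Hdg; ring].
    - transitivity (p * q * (f22 * g12 - f12 * (e * f * g22)))%Z; [ring|].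
      rewrite Hg22, Hg12; transitivity (p * q * b0 * (f11 * f22 - f12 * f21))%Z; [ring|rewrite Hdf; ring].
    - transitivity (p * q * (f12 * (e * f * g21) - f22 * g11))%Z; [ring|].
      rewrite Hg21, Hg11; transitivity (- p * q * a0 * (f11 * f22 - f12 * f21))%Z; [ring|rewrite Hdf; ring].
    - transitivity (p * q * (f11 * (e * f * g22) - f21 * g12))%Z; [ring|].
      rewrite Hg22, Hg12; transitivity (p * q * e0 * (f11 * f22 - f12 * f21))%Z; [ring|rewrite Hdf; ring].
    - transitivity (p * q * (f21 * g11 - f11 * (e * f * g21)))%Z; [ring|].
      rewrite Hg21, Hg11; transitivity (- p * q * c0 * (f11 * f22 - f12 * f21))%Z; [ring|rewrite Hdf; ring].
    - transitivity (f * q * q * (f11 * f22 - f12 * f21))%Z; [ring|rewrite Hdf; ring]. }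
  exists u, v; split; [split; [|split]|exact Hclass].
  - intros E; unfold toC2, u, realvec in E; simpl in E.
    destruct (Z.eq_dec q 0) as [Hq|Hq].
    + apply (f_equal snd) in E; cbv [snd] in E.
      assert (Hp : p <> 0%Z) by (intros ->; subst q; lia).
      apply (lattice_number_neq_0 tau2 (p * g11) (p * g12) Ht2); [|exact E].
      destruct (Z.eq_dec g11 0) as [->|]; [|left; nia].
      destruct (Z.eq_dec g12 0) as [->|]; [lia|right; nia].
    + apply (f_equal fst) in E; cbv [fst] in E.
      assert (f * q <> 0)%Z by nia.
      apply (lattice_number_neq_0 tau1 (f * q * f11) (f * q * f12) Ht1); [|exact E].
      destruct (Z.eq_dec f11 0) as [->|]; [|left; nia].
      destruct (Z.eq_dec f12 0) as [->|]; [lia|right; nia].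
  - set (F1 := Cplus (CofZ f11) (Cmult (CofZ f12) tau1)).
    set (F2 := Cplus (CofZ f21) (Cmult (CofZ f22) tau1)).
    set (G1 := Cplus (CofZ g11) (Cmult (CofZ g12) tau2)).
    set (G2 := Cplus (CofZ g21) (Cmult (CofZ g22) tau2)).
    set (al := Cplus (CofZ a0) (Cmult (CofZ b0) tau2)).
    assert (HG1 : G1 = Cmult al F1).
    { unfold G1, F1; rewrite Hg11, Hg12, !CofZ_add, !CofZ_mul.
      transitivity (Cplus (Cmult (CofZ f11) al) (Cmult (CofZ f12) (Cmult al tau1))); [|ring].
      unfold al at 2; rewrite Hhom; unfold al; ring. }
    assert (HG2 : Cmult (Cmult (CofZ e) (CofZ f)) G2 = Cmult al F2).
    { unfold G2, F2.
      transitivity (Cplus (CofZ (e * f * g21)) (Cmult (CofZ (e * f * g22)) tau2));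
        [rewrite !CofZ_mul; ring|].
      rewrite Hg21, Hg22, !CofZ_add, !CofZ_mul.
      transitivity (Cplus (Cmult (CofZ f21) al) (Cmult (CofZ f22) (Cmult al tau1))); [|ring].
      unfold al at 2; rewrite Hhom; unfold al; ring. }
    assert (HF1 : F1 <> RtoC 0).
    { apply lattice_number_neq_0; [exact Ht1|].
      destruct (Z.eq_dec f11 0) as [->|]; [|now left].
      destruct (Z.eq_dec f12 0) as [->|]; [lia|now right]. }
    assert (HfC : CofZ f <> RtoC 0).
    { intros E; apply (f_equal Re) in E; simpl in E; apply eq_IZR_R0 in E; lia. }
    (* The first coordinates f q F1 and q F2 of [u] and [v] dictate this ratio. It also fits the
       second ones, since G1 = al F1 and e f G2 = al F2. *)
    set (lam := Cdiv F2 (Cmult (CofZ f) F1)).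
    assert (Hlam : Cmult lam (Cmult (CofZ f) F1) = F2) by (unfold lam; field; auto).
    exists lam; split.
    + clearbody lam. clear - Ht1 Hf Hdf Hlam.
      destruct tau1 as [s1 t1], lam as [lr li].
      unfold F1, F2, Cmult, Cplus, CofZ, RtoC in Hlam; simpl in Hlam; simpl in *.
      injection Hlam; clear Hlam; intros E2 E1.
      apply (f_equal IZR) in Hdf; rewrite minus_IZR, !mult_IZR in Hdf.
      apply IZR_lt in Hf.
      set (X := IZR f11 + IZR f12 * s1) in *; set (Y := IZR f12 * t1) in *.
      (* f |F1|^2 Im lam = Im (conj(F1) F2) = Im tau1, because (f1, f2) is positively oriented. *)
      assert (E : IZR f * (X * X + Y * Y) * li = t1).
      { transitivity (X * (IZR f22 * t1) - Y * (IZR f21 + IZR f22 * s1)).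
        - replace (IZR f22 * t1) with (0 + (IZR f22 * t1 + 0 * s1)) by ring.
          replace (IZR f21 + IZR f22 * s1) with (IZR f21 + (IZR f22 * s1 - 0 * t1)) by ring.
          rewrite <- E1, <- E2; unfold X, Y; ring.
        - transitivity (t1 * (IZR f11 * IZR f22 - IZR f12 * IZR f21));
            [unfold X, Y; ring|rewrite Hdf; ring]. }
      destruct (Rlt_or_le 0 li) as [Hli|Hli]; [exact Hli|exfalso].
      pose proof (Rle_0_sqr X) as HX; pose proof (Rle_0_sqr Y) as HY; unfold Rsqr in HX, HY.
      assert (0 <= IZR f * (X * X + Y * Y)) by (apply Rmult_le_pos; lra).
      nra.
    + assert (Eu : toC2 tau1 tau2 (realvec u) =
        (Cmult (Cmult (CofZ f) (CofZ q)) F1, Cmult (CofZ p) G1)).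
      { unfold toC2, realvec, u; simpl.
        apply injective_projections; cbv [fst snd].
        - transitivity (Cplus (CofZ (f * q * f11)) (Cmult (CofZ (f * q * f12)) tau1)); [reflexivity|].
          rewrite !CofZ_mul; unfold F1; ring.
        - transitivity (Cplus (CofZ (p * g11)) (Cmult (CofZ (p * g12)) tau2)); [reflexivity|].
          rewrite !CofZ_mul; unfold G1; ring. }
      rewrite Eu; unfold toC2, realvec, v; simpl.
      apply injective_projections; cbv [fst snd].
      * transitivity (Cplus (CofZ (q * f21)) (Cmult (CofZ (q * f22)) tau1)); [reflexivity|].
        transitivity (Cmult (CofZ q) F2); [rewrite !CofZ_mul; unfold F2; ring|].
        rewrite <- Hlam; ring.
      * transitivity (Cplus (CofZ (e * p * g21)) (Cmult (CofZ (e * p * g22)) tau2)); [reflexivity|].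
        transitivity (Cmult (CofZ p) (Cmult (CofZ e) G2)); [rewrite !CofZ_mul; unfold G2; ring|].
        assert (HeG : Cmult (CofZ e) G2 = Cmult lam G1).
        { transitivity (Cdiv (Cmult (Cmult (CofZ e) (CofZ f)) G2) (CofZ f)); [field; auto|].
          rewrite HG2, HG1, <- Hlam; field; auto. }
        rewrite HeG; ring.
  - intros x a b E; unfold u, v, realvec in E; cbv [n1 n2 n3 n4] in E.
    destruct x as [y1 y2 y3 y4].
    injection E; clear E; intros E4 E3 E2 E1.
    rewrite !mult_IZR in E1, E2, E3, E4.
    pose proof (f_equal IZR Hdf) as Rdf; pose proof (f_equal IZR Hdg) as Rdg.
    pose proof (f_equal IZR Hbez) as Rbez.
    rewrite minus_IZR in Rdf, Rdg, Rbez; 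
    rewrite !mult_IZR in Rdf; rewrite !mult_IZR in Rdg; rewrite !mult_IZR in Rbez.
    (* Determinants against f2 and g2 give a f q and a p, those against f1 and g1 give b q and b e
       p; [Hbez] recovers a and b as integer combinations. *)
    set (m := (- r * (y1 * f22 - y2 * f21) + e * s * (y3 * g22 - y4 * g21))%Z).
    set (k := (- f * r * (f11 * y2 - f12 * y1) + s * (g11 * y4 - g12 * y3))%Z).
    assert (Hm : a = IZR m).
    { unfold m; repeat rewrite ?plus_IZR, ?minus_IZR, ?mult_IZR, ?opp_IZR; rewrite E1, E2, E3, E4.
      symmetry; transitivity (a * (IZR e * IZR p * IZR s * (IZR g11 * IZR g22 - IZR g12 * IZR g21)
        - IZR f * IZR r * IZR q * (IZR f11 * IZR f22 - IZR f12 * IZR f21))); [ring|].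
      rewrite Rdf, Rdg; transitivity (a * (IZR e * IZR p * IZR s - IZR f * IZR r * IZR q)); [ring|].
      rewrite Rbez; ring. }
    assert (Hk : b = IZR k).
    { unfold k; repeat rewrite ?plus_IZR, ?minus_IZR, ?mult_IZR, ?opp_IZR; rewrite E1, E2, E3, E4.
      symmetry; transitivity (b * (IZR e * IZR p * IZR s * (IZR g11 * IZR g22 - IZR g12 * IZR g21)
        - IZR f * IZR r * IZR q * (IZR f11 * IZR f22 - IZR f12 * IZR f21))); [ring|].
      rewrite Rdf, Rdg; transitivity (b * (IZR e * IZR p * IZR s - IZR f * IZR r * IZR q)); [ring|].
      rewrite Rbez; ring. }
    exists m, k; unfold u, v; cbv [n1 n2 n3 n4]; rewrite Hm, Hk in *; clear - E1 E2 E3 E4.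
    f_equal; apply eq_IZR; rewrite plus_IZR, !mult_IZR; assumption.
Qed.

(** The class of the first curve serves: it is isotropic, and its product with the sum of the two
    curves is their intersection number 1. *)
Lemma reducible_pp_splits (tau1 tau2 : C) (a0 b0 c0 e0 x y z : Z) :
  0 < Im tau1 -> 0 < Im tau2 ->
  (forall a b c e, lattice_hom tau1 tau2 a b c e ->
      exists k, (a = k * a0 /\ b = k * b0 /\ c = k * c0 /\ e = k * e0)%Z) ->
  reducible_pp tau1 tau2 (ns_class a0 b0 c0 e0 x y z) ->
  exists x' y' z', (x' * y' = (a0 * e0 - b0 * c0) * z' * z' /\
    x * y' + y * x' - 2 * (a0 * e0 - b0 * c0) * z * z' = 1)%Z.
Proof.
  intros Ht1 Ht2 Hgen (u1 & v1 & u2 & v2 & H1 & H2 & H12 & HA).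
  pose proof (curve_class_isotropic u1 v1) as Hiso.
  assert (HL : intAlt (curve_class u1 v1) (ns_class a0 b0 c0 e0 x y z) = 1%Z).
  { rewrite HA, intAlt_addAlt_r, Hiso, H12; reflexivity. }
  destruct (isNS_ex_ns_class tau1 tau2 a0 b0 c0 e0 (curve_class u1 v1)) as (x' & y' & z' & E);
    try assumption; [now apply curve_class_isNS|].
  rewrite E, intAlt_ns_class in *.
  exists x', y', z'; split; lia.
Qed.

(** * Irreducible polarizations and idoneal degrees *)

Theorem mainTheorem13 (tau1 tau2 : C) :
  0 < Im tau1 -> 0 < Im tau2 ->
  ~ hasCM tau1 -> ~ hasCM tau2 ->
  forall d : nat, minimal_isogeny_degree tau1 tau2 d ->
  ((~ exists A : Alt, irreducible_pp tau1 tau2 A) <->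
   (d = 1%nat \/
    (idoneal d /\ (d mod 8 = 2 \/ d mod 8 = 4 \/ d mod 8 = 6)%nat))).
Proof.
  intros Ht1 Ht2 HCM1 _ d Hmin.
  destruct (minimal_isogeny_generates _ _ _ Ht1 Ht2 HCM1 Hmin)
    as (a0 & b0 & c0 & e0 & Hhom & Hdeg & Hpos & Hgen).
  assert (Hmod : (d mod 8 = 2 \/ d mod 8 = 4 \/ d mod 8 = 6)%nat <->
    (Z.of_nat d mod 8 = 2 \/ Z.of_nat d mod 8 = 4 \/ Z.of_nat d mod 8 = 6)%Z).
  { change 8%Z with (Z.of_nat 8); rewrite <- Nat2Z.inj_mod; lia. }
  rewrite Hmod, idoneal_iff_idonealZ by lia.
  split.
  - intros Hno; apply NNPP; intros Hnot; apply not_or_and in Hnot as [Hd1 Hnot].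
    destruct (nonsplit_polarization_exists (Z.of_nat d)) as (a & b & c & Ha & Hpp & Hns);
      [exact Hpos|lia|exact Hnot|].
    apply Hno; exists (ns_class a0 b0 c0 e0 a b c); split; [split; [|split]|].
    + now apply isNS_ns_class.
    + apply ampleNS_ns_class_iff; try assumption; rewrite Hdeg; exact Hpp.
    + rewrite intAlt_ns_class, Hdeg; lia.
    + intros Hred; apply reducible_pp_splits in Hred as (x & y & z & H1 & H2); try assumption.
      rewrite Hdeg in H1, H2; exact (Hns x y z H1 H2).
  - intros Hcase [A [(HNS & Hample & Hpp) Hirr]]; apply Hirr; clear Hirr.
    destruct (isNS_ex_ns_class _ _ a0 b0 c0 e0 A Ht1 Ht2 Hgen HNS) as (a & b & c & ->).
    assert (Hpp' : (a * b - Z.of_nat d * c * c = 1)%Z).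
    { rewrite intAlt_ns_class, Hdeg in Hpp; lia. }
    apply ampleNS_ns_class_iff in Hample; try assumption; [|rewrite Hdeg; exact Hpp'].
    destruct (idoneal_polarization_splits (Z.of_nat d) a b c)
      as (e & f & p & q & r & s & He & Hf & Hef & Hdet & -> & -> & ->); try assumption.
    { destruct Hcase as [->|H]; [now left|now right]. }
    destruct (smith_normal_form a0 b0 c0 e0 (Z.of_nat d))
      as (f11 & f12 & f21 & f22 & g11 & g12 & g21 & g22 & F & G & E1 & E2 & E3 & E4); try assumption.
    (* A prime dividing all entries could be divided out; the quotient would be k times the
       generator, so k l = 1. *)
    { intros l Hl [a' Ea] [b' Eb] [c' Ec] [e' Ee].
      assert (Hhom' : lattice_hom tau1 tau2 a' b' c' e').
      { destruct tau1 as [s1 t1], tau2 as [s2 t2]; apply lattice_hom_iff in Hhom as [R1 R2].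
        pose proof (prime_ge_2 l Hl).
        assert (Hl0 : IZR l <> 0) by (apply not_0_IZR; lia).
        rewrite Ea, Eb, Ec, Ee, !mult_IZR in R1; rewrite Ea, Eb, Ee, !mult_IZR in R2.
        apply lattice_hom_iff; split; apply (Rmult_eq_reg_r (IZR l)); try assumption; lra. }
      destruct (Hgen _ _ _ _ Hhom') as (k & K1 & K2 & K3 & K4).
      assert (Hkl : (k * l = 1)%Z).
      { apply (Z.mul_reg_r _ _ (Z.of_nat d)); [lia|]; rewrite <- Hdeg.
        transitivity ((k * a0) * l * e0 - (k * b0) * l * c0)%Z; [ring|].
        rewrite <- K1, <- K2, <- Ea, <- Eb; ring. }
      pose proof (prime_ge_2 l Hl).
      rewrite Z.mul_comm in Hkl; destruct (Z.mul_eq_1 l k Hkl); lia. }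
    rewrite <- Hef in E3, E4.
    destruct (elliptic_curve_of_splitting tau1 tau2 a0 b0 c0 e0 e f p q r s
      f11 f12 f21 f22 g11 g12 g21 g22) as (u1 & v1 & B1 & C1); try assumption.
    (* The complementary curve: replacing (e, f, p, q, r, s) by (f, e, r, s, -p, -q) preserves the
       determinant condition and gives the class (f r^2, e s^2, -rs). *)
    destruct (elliptic_curve_of_splitting tau1 tau2 a0 b0 c0 e0 f e r s (- p) (- q)
      f11 f12 f21 f22 g11 g12 g21 g22) as (u2 & v2 & B2 & C2);
      try assumption; try (rewrite (Z.mul_comm f e); assumption); [lia|].
    exists u1, v1, u2, v2; split; [exact B1|split; [exact B2|]].
    rewrite C1, C2, intAlt_ns_class, addAlt_ns_class, Hdeg, <- Hef; split.
    + transitivity ((e * p * s - f * r * q) * (e * p * s - f * r * q))%Z; [ring|rewrite Hdet; ring].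
    + f_equal; ring.
Qed.
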